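(* Let $l \in \{5,6,7\}$. Every planar graph $G$ containing no cycle of length $4$ and no cycle of length $l$ is $1$-defective $3$-paintable.
   Context: Graphs are finite and simple. Cycles are subgraphs, not necessarily induced. Given a graph $G$ and non-negative integers $k,d$, the $d$-defective $k$-painting game on $G$ is played by two players, Lister and Painter. Initially each vertex has $k$ tokens and is uncolored. In each round, Lister selects a nonempty set $M$ of uncolored vertices and takes away one token from each vertex in $M$; then Painter colors a subset $X$ of $M$ such that the induced subgraph $G[X]$ has maximum degree at most $d$ (the vertices of $X$ are colored from then on). If at the end of some round there is an uncolored vertex with no tokens left, then Lister wins. Otherwise, at the end of some round all vertices are colored, and Painter wins. $G$ is $d$-defective $k$-paintable if Painter has a winning strategy in the $d$-defective $k$-painting game on $G$. *)

(* Defs.v *)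
From HB Require Import structures.
From mathcomp Require Import all_boot all_order all_algebra.
From mathcomp Require Import classical_sets reals topology normedtype.
Set Implicit Arguments.
Unset Strict Implicit.
Unset Printing Implicit Defensive.
Import Order.TTheory GRing.Theory Num.Theory.
Import numFieldNormedType.Exports.

(* A finite simple graph is a symmetric irreflexive relation [e] on a finite  *)
(* type of vertices.                                                          *)

(* The bound 2 < n is needed because [ucycle] also accepts sequences of size  *)
(* at most 2 (for instance both ends of an edge).                             *)
Definition has_cycle (T : finType) (e : rel T) (n : nat) : Prop :=
  exists c : seq T, [/\ (2 < n)%N, size c = n & ucycle e c].

Section Planarity.
Local Open Scope classical_set_scope.
Local Open Scope ring_scope.

(* The edge xy is drawn as the arc t |-> g x y t, for t in [0, 1], from p x   *)
(* to p y; [g y x] is the same arc traversed backwards.                       *)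
Record plane_drawing (R : realType) (T : finType) (e : rel T)
    (p : T -> R * R) (g : T -> T -> R -> R * R) : Prop := {
  drawing_vertex_inj : injective p ;
  drawing_arc_cont : forall x y, e x y ->
    {within `[0, 1], continuous (g x y)} ;
  drawing_arc_inj : forall x y, e x y -> {in `[0, 1] &, injective (g x y)} ;
  drawing_arc_src : forall x y, e x y -> g x y 0 = p x ;
  drawing_arc_tgt : forall x y, e x y -> g x y 1 = p y ;
  drawing_arc_rev : forall x y (t : R), e x y -> t \in `[0, 1] ->
    g y x t = g x y (1 - t) ;
  drawing_avoids_vertices : forall x y z (t : R), e x y -> t \in `]0, 1[ ->
    g x y t <> p z ;
  drawing_no_crossing : forall x y u v (s t : R), e x y -> e u v ->
    [set x; y]%SET != [set u; v]%SET -> s \in `]0, 1[ -> t \in `]0, 1[ ->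
    g x y s <> g u v t
}.

Definition planar (R : realType) (T : finType) (e : rel T) : Prop :=
  exists (p : T -> R * R) (g : T -> T -> R -> R * R), plane_drawing e p g.

End Planarity.

Section PaintingGame.
Variables (T : finType) (e : rel T).

(* The induced subgraph on X has maximum degree at most d.                    *)
Definition defective (d : nat) (X : {set T}) : Prop :=
  forall v, v \in X -> (#|[set w in X | e v w]| <= d)%N.

(* A history is the list of the sets chosen by Lister so far, MOST RECENT     *)
(* FIRST. A strategy for Painter maps a nonempty history M :: h to the set of *)
(* vertices colored in answer to M; its value on [::] is irrelevant.          *)
Definition strategy := seq {set T} -> {set T}.

Fixpoint uncolored (s : strategy) (h : seq {set T}) : {set T} :=
  if h is _ :: h' then uncolored s h' :\: s h else [set: T].

Definition tokens (k : nat) (h : seq {set T}) (v : T) : nat :=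
  k - count (fun M : {set T} => v \in M) h.

Fixpoint legal (s : strategy) (h : seq {set T}) : bool :=
  if h is M :: h' then
    [&& M != finset.set0, M \subset uncolored s h' & legal s h']
  else true.

(* Painter always answers according to the rules, and Lister never reaches    *)
(* his goal. As every round consumes a token, plays are finite: a play in     *)
(* which Lister never reaches his goal ends with all the vertices colored.    *)
(* The clause on tokens includes the empty history, which only matters for    *)
(* k = 0: then only the empty graph is paintable.                             *)
Definition winning (d k : nat) (s : strategy) : Prop :=
  forall h, legal s h ->
    (forall v, v \in uncolored s h -> (0 < tokens k h v)%N) /\
    (forall M h', h = M :: h' -> s h \subset M /\ defective d (s h)).

Definition paintable (d k : nat) : Prop :=
  exists s : strategy, winning d k s.

End PaintingGame.

(* Main.v *)
Require Import Defs.
From mathcomp Require Import all_boot all_order all_algebra.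
From mathcomp Require Import zify lra boolp.
Set Implicit Arguments.
Unset Strict Implicit.
Unset Printing Implicit Defensive.

(* The proof uses no Jordan curve theorem. By compactness a drawing exhibits  *)
(* G as a minor of a fine square grid. A grid has an abstract dual in the     *)
(* sense of Whitney (even edge sets are the cuts of the dual), this property  *)
(* passes to minors, and a rank computation over F_2 turns it into Euler's    *)
(* inequality, with the boundaries of faces being even edge sets.             *)
(* In the painting game, a vertex of degree at most 2, an edge between two    *)
(* vertices of degree 3, and a triangle with degrees 3, 4, 4 are reducible:   *)
(* Painter wins on them with the tokens that the rest of the graph leaves.    *)
(* If none of them occurs, then discharging on an end block of G, whose cut   *)
(* vertex v0 may be exceptional, contradicts Euler's inequality.              *)

(** * The painting game *)

(** Painter wins on every induced subgraph G[S], by induction on S. Suppose that he wins on S minus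
    H with 3 tokens per vertex. He plays that game and answers on H only with vertices that have no
    neighbour colored in the same round. A vertex v of H thus loses at most one token per neighbour
    in S minus H and keeps 3 - deg_S v + deg_H v tokens ([painter_wins_union]). This suffices if H
    is a vertex of degree at most 2, an edge with degrees 3, 3, or a triangle with degrees 3, 4, 4.
    So it is enough to find one of these in every nonempty G[S] ([paintable_of_reducible],
    [reducible_of_dual]).

    Suppose that G[S] has none of them and take an end block, in which only the root v0 may have
    lost neighbours. Give a vertex v the charge 6 deg v - 18 and a face of length n the charge 3n -
    18. By Euler's inequality the total is at most -36. No face has length 4, so the only faces in
    debt are triangles (9) and pentagons (3). Triangular faces share no edge, and a forbidden cycle
    of length 5, 6 or 7 restricts how pentagons meet triangles, so vertices of degree at least 4 can
    pay. If l = 7, a triangle with a vertex a of degree 3 may still lack 1, which comes from v0 if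
    v0 is adjacent to a, or else from a face of length at least 8 at a ([big_face_near_tri]). In the
    end v0 has at least -18 and all the rest is nonnegative, a contradiction ([discharging]).

    Planarity enters only through [abstract_dual]. A drawing is sampled finely
    ([plane_drawing_dual]), which makes G a minor of a grid ([sampled_drawing_dual],
    [grid_drawing_dual]). The grid has a dual ([grid_dual]), deletion and contraction preserve duals
    ([abstract_dual_sub], [abstract_dual_minor]), and a dual gives [euler] by linear algebra.
    Duality applied to a cycle through a given vertex also replaces the usual facts on faces of
    2-connected plane graphs ([edges_not_parallel]). *)

Section Game.
Variables (T : finType) (e : rel T) (d : nat).

Definition spend (t : T -> nat) (M : {set T}) (v : T) : nat := t v - (v \in M).

(** An invariant of positions that Painter can maintain. Positions replace histories here, so that
    games on disjoint sets of vertices can be combined. *)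
Definition safe (W : {set T} -> (T -> nat) -> Prop) : Prop :=
  forall U t, W U t ->
    (forall v, v \in U -> 0 < t v) /\
    (forall M : {set T}, M \subset U -> M != set0 ->
      exists X : {set T}, [/\ X \subset M, defective e d X & W (U :\: X) (spend t M)]).

Definition painter_wins (U : {set T}) (t : T -> nat) : Prop :=
  exists2 W, safe W & W U t.

(** A history determines the current position, and the strategy picks a good reply to it by choice;
    the value [set0] is taken only at positions outside the invariant or for illegal moves. *)
Lemma paintable_of_painter_wins k :
  painter_wins [set: T] (fun=> k) -> paintable e d k.
Proof.
case=> W sW W0.
pose good U t (M X : {set T}) :=
  [/\ X \subset M, defective e d X & W (U :\: X) (spend t M)].
pose reply U t M := if pselect (exists X, good U t M X) is left ex then projT1 (cid ex)
                    else set0.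
pose fix unc h := if h is M :: h' then unc h' :\: reply (unc h') (tokens k h') M
                  else [set: T].
pose s (h : seq {set T}) :=
  if h is M :: h' then reply (unc h') (tokens k h') M else set0.
have uncE h : uncolored s h = unc h by elim: h => //= M h ->.
have tokE M h : tokens k (M :: h) = spend (tokens k h) M.
  by apply/funext => v; rewrite /tokens /spend /=; lia.
exists s.
have step M h : W (unc h) (tokens k h) -> M != set0 -> M \subset unc h ->
    good (unc h) (tokens k h) M (reply (unc h) (tokens k h) M).
  move=> Wh M0 MU; have [_ /(_ _ MU M0) gX] := sW _ _ Wh.
  by rewrite /reply; case: pselect => // ex; case: (cid ex).
have inv h : legal s h -> W (unc h) (tokens k h).
  elim: h => [_|M h IH /= /and3P[M0 MU /IH Wh]].
    by rewrite (_ : tokens k [::] = fun=> k) //; apply/funext => v; rewrite /tokens subn0.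
  rewrite uncE in MU.
  by have [_ _] := step _ _ Wh M0 MU; rewrite tokE.
move=> h hl; split.
  by move=> v; rewrite uncE; have [+ _] := sW _ _ (inv _ hl); apply.
move=> M h' hE; subst h; move: hl => /= /and3P[M0 MU /inv Wh].
rewrite uncE in MU.
by have [? ? _] := step _ _ Wh M0 MU.
Qed.

Lemma painter_wins_set0 t : painter_wins set0 t.
Proof.
exists (fun U _ => U = set0) => // _ {}t ->; split=> [v|M]; first by rewrite inE.
by rewrite subset0 => ->.
Qed.

Definition nbrs (A : {set T}) (v : T) : nat := #|[set w in A | e v w]|.

Hypothesis e_sym : symmetric e.

(* A vertex of U2 that Lister selects while one of its neighbours in U1 gets  *)
(* colored skips the round; this costs it one token per neighbour in U1.      *)
Lemma painter_wins_union (U1 U2 : {set T}) t f :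
  [disjoint U1 & U2] -> painter_wins U1 t -> painter_wins U2 f ->
  (forall v, v \in U2 -> f v + nbrs U1 v <= t v) ->
  painter_wins (U1 :|: U2) t.
Proof.
move=> dis [W1 sW1 W1t] [W2 sW2 W2f] tf.
(* Each of the two games has its own token count: [t1] agrees with [t] on U1 only, and [f] stays
   below [t] on U2 by one token for each neighbour still uncolored in U1. *)
pose W (U : {set T}) t := exists (U1 U2 : {set T}) t1 f, [/\ [disjoint U1 & U2], U = U1 :|: U2,
  W1 U1 t1 /\ {in U1, t1 =1 t}, W2 U2 f &
  (forall v, v \in U2 -> f v + nbrs U1 v <= t v)].
exists W; last by exists U1, U2, t, f.
move=> {t f U1 U2 dis W1t W2f tf} _ t [U1 [U2 [t1 [f [dis -> [W1t t1t] W2f tf]]]]].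
have [pos1 play1] := sW1 _ _ W1t; have [pos2 play2] := sW2 _ _ W2f.
split=> [v|M MU M0].
  rewrite inE => /orP[vU|vU]; first by rewrite -t1t ?pos1.
  by have := pos2 _ vU; have := tf _ vU; lia.
have [X1 [t1' [X1M X1U X1d [W1X tX]]]] : exists (X1 : {set T}) t1', [/\ X1 \subset M, X1 \subset U1,
    defective e d X1 & W1 (U1 :\: X1) t1' /\ {in U1, t1' =1 spend t M}].
  case: (eqVneq (M :&: U1) set0) => [M10|M10].
    exists set0, t1; rewrite !sub0set setD0; split=> //; first by move=> v; rewrite inE.
    split=> // v vU; rewrite t1t // /spend.
    suff -> : (v \in M) = false by rewrite subn0.
    by apply/negP => vM; move/setP/(_ v): M10; rewrite !inE vM vU.
  have [X [XM Xd WX]] := play1 _ (subsetIr M U1) M10.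
  exists X, (spend t1 (M :&: U1)); split=> //.
  - exact: subset_trans XM (subsetIl _ _).
  - exact: subset_trans XM (subsetIr _ _).
  - by split=> // v vU; rewrite /spend inE vU andbT t1t.
pose M2 := [set v in M :&: U2 | nbrs X1 v == 0].
have [X2 [f' [X2M X2d W2X fX]]] : exists (X2 : {set T}) f', [/\ X2 \subset M2,
    defective e d X2, W2 (U2 :\: X2) f' & f' =1 spend f M2].
  case: (eqVneq M2 set0) => [M20|M20].
    exists set0, f; rewrite sub0set setD0 M20; split=> // v; first by rewrite inE.
    by rewrite /spend inE subn0.
  have M2U : M2 \subset U2 by apply/subsetP=> v; rewrite !inE => /andP[/andP[]].
  by have [X [XM Xd WX]] := play2 _ M2U M20; exists X, (spend f M2).
have X2M' : X2 \subset M by apply: subset_trans X2M _; apply/subsetP=> v; rewrite !inE => /andP[/andP[]].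
have X2U : X2 \subset U2 by apply: subset_trans X2M _; apply/subsetP=> v; rewrite !inE => /andP[/andP[]].
have nX v w : v \in X1 -> w \in X2 -> e v w = false.
  move=> vX1 /(subsetP X2M); rewrite !inE => /andP[_].
  by rewrite cards_eq0 => /eqP/setP/(_ v); rewrite !inE vX1 /= e_sym.
exists (X1 :|: X2); split; first by rewrite subUset X1M.
  move=> v; rewrite inE => /orP[vX|vX]; [move: (X1d v vX)|move: (X2d v vX)]; apply: leq_trans;
  apply/subset_leq_card/subsetP => w; rewrite !inE.
    by case/andP=> /orP[-> ->//|wX]; rewrite (nX v w).
  by case/andP=> /orP[wX|-> ->//]; rewrite e_sym (nX w v).
exists (U1 :\: X1), (U2 :\: X2), t1', f'; split.
- apply: disjointWl (subsetDl _ _) _; exact: disjointWr (subsetDl _ _) dis.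
- apply/setP=> v; rewrite !inE !negb_or.
  case: (boolP (v \in U1)) => vU1; case: (boolP (v \in U2)) => vU2; rewrite ?andbT ?andbF ?orbF ?orbT //=.
  + by have := disjointFr dis vU1; rewrite vU2.
  + suff -> : (v \in X2) = false by rewrite andbT.
    by apply/negP => /(subsetP X2U); rewrite (negPf vU2).
  + suff -> : (v \in X1) = false by [].
    by apply/negP => /(subsetP X1U); rewrite (negPf vU1).
- by split=> // v; rewrite inE => /andP[_ /tX].
- by [].
- move=> v; rewrite inE => /andP[vX2 vU2]; rewrite fX /spend.
  have := tf _ vU2.
  have nD : nbrs U1 v = nbrs (U1 :\: X1) v + nbrs X1 v.
    rewrite /nbrs -cardsUI addnC (_ : _ :&: _ = set0) ?cards0 ?add0n.
      apply: eq_card => w; rewrite !inE.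
      case: (boolP (w \in X1)) => wX; rewrite ?orbF //=.
      by rewrite (subsetP X1U).
    by apply/setP=> w; rewrite !inE; case: (w \in X1); rewrite ?andbF.
  rewrite nD !inE vU2 andbT.
  have := pos2 _ vU2; move: (f v) (t v) (nbrs _ v) (nbrs X1 v) (v \in M) => fv tv n1 n2 b.
  by clear; case: b; case: (posnP n2) => [->|] /=; lia.
Qed.

End Game.

(** * Reducible configurations *)

Section Reducible.
Variables (T : finType) (e : rel T).
Hypothesis e_irr : irreflexive e.

Lemma defective_card2 (X : {set T}) : #|X| <= 2 -> defective e 1 X.
Proof.
move=> X2 v vX; have: [set w in X | e v w] \subset X :\ v.
  by apply/subsetP => w; rewrite !inE => /andP[-> evw]; rewrite andbT;
     apply/eqP => wv; rewrite wv e_irr in evw.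
by move/subset_leq_card => /leq_trans; apply; move: X2; rewrite (cardsD1 v X) vX.
Qed.

Lemma painter_wins_card2 (U : {set T}) t :
  #|U| <= 2 -> (forall v, v \in U -> 0 < t v) -> painter_wins e 1 U t.
Proof.
move=> U2 tU.
exists (fun (U : {set T}) t => #|U| <= 2 /\ forall v, v \in U -> 0 < t v) => //.
move=> {tU t U2 U} U t [U2 tU]; split=> // M MU M0; exists M; split=> //.
  exact/defective_card2/(leq_trans (subset_leq_card MU)).
split; first exact: leq_trans (subset_leq_card (subsetDl _ _)) U2.
by move=> v; rewrite inE => /andP[/negPf vM vU]; rewrite /spend vM subn0 tU.
Qed.

(** If Lister selects all of U, Painter leaves out [a], which has a second token. Any other
    selection has at most two vertices and is colored entirely. *)
Lemma painter_wins_triangle (U : {set T}) t a :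
  a \in U -> #|U| <= 3 -> (forall v, v \in U -> (v == a) < t v) ->
  painter_wins e 1 U t.
Proof.
move=> aU U3 tU.
pose small (U : {set T}) t := #|U| <= 2 /\ forall v : T, v \in U -> 0 < t v.
pose big (U : {set T}) t := [/\ a \in U, #|U| <= 3 & forall v : T, v \in U -> (v == a) < t v].
have small_safe (U' : {set T}) t' : #|U'| <= 2 -> (forall v, v \in U' -> 0 < t' v) ->
  forall M : {set T}, M \subset U' -> exists X : {set T},
    [/\ X \subset M, defective e 1 X & small (U' :\: X) (spend t' M)].
  move=> U2 tU' M MU; exists M; split=> //.
    exact/defective_card2/(leq_trans (subset_leq_card MU)).
  split; first exact: leq_trans (subset_leq_card (subsetDl _ _)) U2.
  by move=> v; rewrite inE => /andP[/negPf vM vU]; rewrite /spend vM subn0 tU'.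
exists (fun U t => small U t \/ big U t); last by right.
move=> {tU t U3 aU U} U t [[U2 tU]|[aU U3 tU]].
  split=> // M MU _; have [X [? ? ?]] := small_safe _ _ U2 tU M MU.
  by exists X; split=> //; left.
split=> [v /tU|M MU M0]; first by lia.
case: (eqVneq M U) => [->|MneU].
  exists (U :\ a); rewrite subD1set; split=> //.
    by apply: defective_card2; move: U3; rewrite (cardsD1 a) aU.
  have -> : U :\: (U :\ a) = [set a].
    by apply/setP=> v; rewrite !inE; case: eqVneq => [->|_] //=; rewrite andNb.
  left; split=> [|v]; first by rewrite cards1.
  rewrite inE => /eqP->; rewrite /spend aU.
  by have := tU _ aU; rewrite eqxx; lia.
have MltU : #|M| < #|U| by rewrite proper_card // properEneq MneU.
exists M; split=> //; first by apply: defective_card2; lia.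
have UM : #|U :\: M| + #|M| = #|U|.
  by have := cardsID M U; rewrite (setIidPr MU); lia.
left; split=> [|v]; first by move: M0; rewrite -card_gt0; lia.
by rewrite inE => /andP[/negPf vM vU]; rewrite /spend vM subn0; have := tU _ vU; lia.
Qed.

Definition reducible (S : {set T}) : Prop :=
  [\/ exists2 v, v \in S & nbrs e S v <= 2,
      exists u v, [/\ u \in S, v \in S, e u v, nbrs e S u <= 3 & nbrs e S v <= 3] |
      exists a b c, [/\ [/\ a \in S, b \in S & c \in S], e a b && e b c && e c a,
        nbrs e S a <= 3, nbrs e S b <= 4 & nbrs e S c <= 4] ].

Hypothesis e_sym : symmetric e.

Lemma nbrs_setID (S H : {set T}) v : H \subset S ->
  nbrs e S v = nbrs e (S :\: H) v + nbrs e H v.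
Proof.
move=> HS; rewrite /nbrs -cardsUI addnC (_ : _ :&: _ = set0) ?cards0 ?add0n.
  apply: eq_card => w; rewrite !inE.
  by case: (boolP (w \in H)) => wH; rewrite ?orbF //= (subsetP HS).
by apply/setP=> w; rewrite !inE; case: (w \in H); rewrite ?andbF.
Qed.

(** The inequality says that [v] still has [f v] of its 3 tokens after paying one for each neighbour
    in S outside H. *)
Lemma painter_wins_extend (S H : {set T}) f : H \subset S ->
  painter_wins e 1 (S :\: H) (fun=> 3) -> painter_wins e 1 H f ->
  (forall v, v \in H -> f v + nbrs e S v <= 3 + nbrs e H v) ->
  painter_wins e 1 S (fun=> 3).
Proof.
move=> HS wS wH le3.
have SE : (S :\: H) :|: H = S by rewrite setUC -{2}(setID S H) (setIidPr HS).
rewrite -SE; apply: (painter_wins_union e_sym _ wS wH).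
  by rewrite disjoint_sym disjoints_subset setCD subsetUr.
by move=> v vH; have := le3 _ vH; rewrite (nbrs_setID v HS); lia.
Qed.

Lemma nbrs_ge (A : {set T}) (s : seq T) v :
  uniq s -> all [pred w | (w \in A) && e v w] s -> size s <= nbrs e A v.
Proof.
move=> us /allP sA; rewrite -(card_uniqP us); apply/subset_leq_card/subsetP => w ws.
by rewrite !inE; apply: sA.
Qed.

Lemma edge_neq x y : e x y -> x != y.
Proof. by apply: contraTneq => ->; rewrite e_irr. Qed.

Lemma paintable_of_reducible :
  (forall S : {set T}, S != set0 -> reducible S) -> paintable e 1 3.
Proof.
move=> red; apply: paintable_of_painter_wins.
have: forall n (S : {set T}), #|S| <= n -> painter_wins e 1 S (fun=> 3).
  elim=> [|n IH] S Sn.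
    by move: Sn; rewrite leqn0 cards_eq0 => /eqP->; apply: painter_wins_set0.
  have [->|S0] := eqVneq S set0; first exact: painter_wins_set0.
  have IHD (H : {set T}) v : H \subset S -> v \in H -> painter_wins e 1 (S :\: H) (fun=> 3).
    move=> HS vH; apply: IH; rewrite -ltnS (leq_trans _ Sn) // proper_card //.
    by rewrite properE subsetDl /=; apply/subsetPn; exists v; rewrite ?inE ?vH // (subsetP HS).
  case: (red S S0) => [[v vS v2]|[u [v [uS vS euv u3 v3]]]|[a [b [c [[aS bS cS]]]]]].
  - have HS : [set v] \subset S by rewrite sub1set.
    apply: (@painter_wins_extend S [set v] (fun=> 1) HS); first exact: (IHD _ v HS (set11 v)).
      by apply: painter_wins_card2 => //; rewrite cards1.
    by move=> w; rewrite inE => /eqP->; lia.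
  - have HS : [set u; v] \subset S by rewrite subUset !sub1set uS.
    apply: (@painter_wins_extend S [set u; v] (fun=> 1) HS); first by apply: (IHD _ u HS); rewrite !inE eqxx.
      by apply: painter_wins_card2 => //; rewrite cards2; case: (_ != _).
    move=> w; rewrite !inE => /orP[]/eqP->.
      suff: 1 <= nbrs e [set u; v] u by lia.
      apply: (@nbrs_ge _ [:: v]) => //=. by rewrite !inE eqxx orbT euv.
    suff: 1 <= nbrs e [set u; v] v by lia.
    by apply: (@nbrs_ge _ [:: u]) => //=; rewrite !inE eqxx e_sym euv.
  - case/andP=> /andP[eab ebc] eca a3 b4 c4.
    have HS : [set a; b; c] \subset S by rewrite !subUset !sub1set aS bS.
    (* At worst [a] keeps 3 - (3 - 2) = 2 tokens, while [b] and [c] keep 3 - (4 - 2) = 1. *)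
    apply: (@painter_wins_extend S [set a; b; c] (fun v => (v == a).+1) HS);
      first by apply: (IHD _ a HS); rewrite !inE eqxx.
      apply: (painter_wins_triangle (a := a)) => //; first by rewrite !inE eqxx.
      rewrite cardsU cards2 cards1; apply: leq_trans (leq_subr _ _) _; by case: (_ != _).
    have [[ab bc] ca] := (edge_neq eab, edge_neq ebc, edge_neq eca).
    move=> w; rewrite !inE -orbA => /or3P[]/eqP->.
    + suff: 2 <= nbrs e [set a; b; c] a.
        by rewrite eqxx; move: (nbrs e S a) (nbrs e _ a) a3; clear; lia.
      by apply: (@nbrs_ge _ [:: b; c]) => /=; rewrite ?inE ?eqxx ?orbT ?eab ?(e_sym a c) ?eca //= bc.
    + suff: 2 <= nbrs e [set a; b; c] b.
        by rewrite eq_sym (negPf ab); move: (nbrs e S b) (nbrs e _ b) b4; clear; lia.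
      by apply: (@nbrs_ge _ [:: a; c]) => /=; rewrite ?inE ?eqxx ?orbT ?(e_sym b a) ?eab ?ebc //= eq_sym ca.
    + suff: 2 <= nbrs e [set a; b; c] c.
        by rewrite (negPf ca); move: (nbrs e S c) (nbrs e _ c) c4; clear; lia.
      by apply: (@nbrs_ge _ [:: a; b]) => /=; rewrite ?inE ?eqxx ?orbT ?(e_sym c b) ?ebc ?eca //= ab.
by move/(_ #|[set: T]| [set: T]); apply.
Qed.

End Reducible.

(** * Even edge sets and abstract duals *)

Notation "\xor_ ( i | P ) F" := (\big[addb/false]_(i | P%B) F)
  (at level 41, F at level 41, i, P at level 50).
Notation "\xor_ i F" := (\big[addb/false]_i F)
  (at level 41, i at level 0, F at level 41).

Lemma xor_pred1 (I : finType) (i : I) (F : I -> bool) :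
  \xor_ j ((j == i) && F j) = F i.
Proof.
rewrite (bigD1 i) //= eqxx big1 ?addbF // => j /negPf->; by [].
Qed.

Lemma xor_andl (I : finType) (P : pred I) b (F : I -> bool) :
  \xor_(i | P i) (b && F i) = b && \xor_(i | P i) F i.
Proof. by case: b => //; rewrite big1. Qed.

Lemma handshake (T : finType) (a : rel T) :
  symmetric a -> irreflexive a -> \xor_ x \xor_ y a x y = false.
Proof.
move=> a_sym a_irr.
pose lt (x y : T) := enum_rank x < enum_rank y.
have E x : \xor_ y a x y = \xor_ y (lt x y && a x y) (+) \xor_ y (lt y x && a x y).
  rewrite -big_split; apply: eq_bigr => y _ /=; rewrite /lt.
  case: ltngtP => //=; rewrite ?addbF //.
  by move/val_inj/enum_rank_inj => ->; rewrite a_irr.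
rewrite (eq_bigr _ (fun x _ => E x)) big_split /=.
rewrite [X in _ (+) X]exchange_big /=.
under [X in _ (+) X]eq_bigr do under eq_bigr do rewrite a_sym.
by rewrite addbb.
Qed.

Section AbstractDual.
Variables (T F : finType).
Implicit Types (e a : rel T) (D : T -> T -> F).

Definition even_chain e a : Prop :=
  [/\ symmetric a, subrel a e & forall x, \xor_ y a x y = false].

Definition cut D (phi : F -> bool) : rel T :=
  fun x y => phi (D x y) (+) phi (D y x).

Lemma cut_sym D phi : symmetric (cut D phi).
Proof. by move=> x y; rewrite /cut addbC. Qed.

(* The vertices of the dual are the faces; [D x y] and [D y x] are the faces  *)
(* on the two sides of the edge xy, and the even subgraphs are exactly the    *)
(* edge cuts of the dual.                                                     *)
Record abstract_dual e D : Prop := {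
  cut_even : forall phi x, \xor_(y | e x y) cut D phi x y = false ;
  even_cut : forall a, even_chain e a ->
    exists phi, forall x y, e x y -> a x y = cut D phi x y
}.

(* Deleting an edge merges the two faces beside it. *)
Lemma abstract_dual_sub e e' D : symmetric e -> symmetric e' -> subrel e' e ->
  abstract_dual e D -> exists D', abstract_dual e' D'.
Proof.
move=> e_sym e'_sym e'e [cutE evenC].
pose r := [rel f g | [exists x, exists y, [&& e x y, ~~ e' x y, f == D x y & g == D y x]]].
have r_sym : connect_sym r.
  apply: sym_connect_sym => f g /=; apply/existsP/existsP => -[x /existsP[y]] /and4P[exy ne fD gD];
  by exists y; apply/existsP; exists x; rewrite e_sym e'_sym exy ne gD fD.
have rootE x y : e x y -> ~~ e' x y -> fingraph.root r (D x y) = fingraph.root r (D y x).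
  move=> exy nexy; apply/eqP; rewrite root_connect //; apply: connect1.
  by apply/existsP; exists x; apply/existsP; exists y; rewrite exy nexy !eqxx.
exists (fun x y => fingraph.root r (D x y)); split=> [phi x|a [a_sym ae' a_even]].
  rewrite -[RHS](cutE (phi \o fingraph.root r) x) big_mkcond [RHS]big_mkcond; apply: eq_bigr => y _.
  rewrite /cut /=; case: (boolP (e' x y)) => [/e'e -> //|ne].
  by case: ifP => // exy; rewrite (rootE _ _ exy ne) addbb.
have [|phi phiE] := evenC a; first by split=> // x y /ae'/e'e.
exists phi => x y exy'.
have phir f : phi (fingraph.root r f) = phi f.
  have /connectP[p + ->] := connect_root r f.
  elim: p f => //= g p IH f /andP[/existsP[u /existsP[v]]].
  case/and4P => euv nuv /eqP-> /eqP-> pth; rewrite (IH _ pth).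
  have: a u v = false by apply/negP => /ae'; rewrite (negPf nuv).
  by rewrite phiE // /cut; case: (phi (D u v)); case: (phi (D v u)).
by rewrite phiE ?e'e // /cut !phir.
Qed.

End AbstractDual.

(** * Parity joins *)

Section Joins.
Variables (C : finType) (r : rel C).
Hypotheses (r_sym : symmetric r) (r_irr : irreflexive r).

(** The edges of a walk are added mod 2, so repeated edges cancel and the walk need not be a
    path. *)
Lemma path_chain u w : connect r u w ->
  exists J : rel C, [/\ symmetric J, subrel J r &
    forall z, \xor_ v J z v = (z == u) (+) (z == w)].
Proof.
case/connectP=> p + ->; elim: p u => [u _|v p IH u /= /andP[ruv /IH[J [J_sym Jr Jrow]]]].
  by exists (fun _ _ => false); split=> // z; rewrite big1 //= addbb.
have uv : (u == v) = false by apply: contraTF ruv => /eqP->; rewrite r_irr.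
pose E (z t : C) := ((t == v) && (z == u)) (+) ((t == u) && (z == v)).
exists (fun z t => E z t (+) J z t); split.
- by move=> z t; rewrite /E J_sym; case: (z == u); case: (t == v); case: (t == u); case: (z == v).
- move=> z t; rewrite /E; case: (boolP (J z t)) => [/Jr//|_]; rewrite addbF.
  case: (boolP ((t == v) && _)) => [/andP[/eqP-> /eqP->]//|_ /=].
  by case/andP=> /eqP-> /eqP->; rewrite r_sym.
- move=> z; rewrite big_split /= Jrow big_split /= !xor_pred1.
  by case: (z == u); case: (z == v); case: (z == _).
Qed.

(** The mod 2 sum of paths from each [u] in [p] to its base [b u]. It moves all odd vertices of a
    branch set to the base of that set. *)
Lemma join_chain (p : pred C) (b : C -> C) :
  (forall u, p u -> connect r u (b u)) ->
  exists J : rel C, [/\ symmetric J, subrel J r &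
    forall z, \xor_ v J z v = p z (+) \xor_ u (p u && (z == b u))].
Proof.
move=> conn.
have /choice[J HJ] : forall u, exists J : rel C, [/\ symmetric J, subrel J r &
    forall z, \xor_ v J z v = p u && ((z == u) (+) (z == b u))].
  move=> u; case: (boolP (p u)) => [/conn/path_chain[J ?]|_]; first by exists J.
  by exists (fun _ _ => false); split=> // z; rewrite big1.
exists (fun z v => \xor_ u J u z v); split.
- by move=> z v; apply: eq_bigr => u _; case: (HJ u) => ->.
- move=> z v; case: (boolP (r z v)) => // nr; rewrite big1 // => u _.
  by apply/negP => Juv; case: (HJ u) => _ /(_ _ _ Juv); rewrite (negPf nr).
- move=> z; rewrite exchange_big /=.
  have E u : \xor_ v J u z v = ((u == z) && p u) (+) (p u && (z == b u)).
    by case: (HJ u) => _ _ ->; rewrite eq_sym; case: (p u); rewrite /= ?andbT ?andbF.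
  by rewrite (eq_bigr _ (fun u _ => E u)) big_split /= xor_pred1.
Qed.

End Joins.

(** * Contraction preserves abstract duals *)

Section Minor.
Variables (C T F : finType) (e1 : rel C) (e : rel T) (D1 : C -> C -> F).
Variables (pi : C -> option T) (m : T -> T -> C * C) (b : T -> C).

(** [pi] sends a vertex of the large graph to its branch set ([None] if it is discarded), [m x y] is
    the edge representing xy, and [b x] is a base point of the branch set of x. By [model_edges] all
    edges leaving a branch set represent edges of [e], so this is pure contraction; deletions are
    made before, by [abstract_dual_sub]. *)
Record minor_model : Prop := {
  model_sym1 : symmetric e1 ;
  model_irr1 : irreflexive e1 ;
  model_irr : irreflexive e ;
  model_edge : forall x y, e x y ->
    [/\ e1 (m x y).1 (m x y).2, pi (m x y).1 = Some x & pi (m x y).2 = Some y] ;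
  model_rev : forall x y, e x y -> m y x = ((m x y).2, (m x y).1) ;
  model_edges : forall u v, e1 u v -> pi u <> pi v ->
    exists x y, e x y /\ m x y = (u, v) ;
  model_fibre : forall u x, pi u = Some x ->
    connect [rel v w | e1 v w && (pi v == pi w)] u (b x)
}.

Hypothesis M : minor_model.

Lemma model_reindex (s : C -> C -> bool) x :
  \xor_(u | pi u == Some x) \xor_(v | e1 u v && (pi u != pi v)) s u v =
  \xor_(y | e x y) s (m x y).1 (m x y).2.
Proof.
rewrite pair_big_dep /=.
rewrite (reindex_onto (fun y => m x y) (fun p => odflt x (pi p.2))) /=; last first.
  move=> [u v] /= /andP[/eqP ux /andP[euv /eqP ne]].
  have [x' [y [exy mE]]] := model_edges M euv ne.
  have [_ + +] := model_edge M exy; rewrite mE /= ux => -[->] -> /=; exact: mE.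
apply: eq_bigl => y; apply/idP/idP; last first.
  move=> exy; have [-> -> ->] := model_edge M exy; rewrite !eqxx /= andbT.
  by apply: contraTneq exy => -[->]; rewrite (model_irr M).
case/andP=> /andP[/eqP m1 /andP[em /eqP ne]] /eqP yE.
have [x' [y' [exy mE]]] := model_edges M em ne.
have [_ + +] := model_edge M exy; rewrite mE /= m1 => -[xx'] m2.
by move: yE; rewrite m2 /= => <-; rewrite xx'.
Qed.

(** For cuts, sum the condition over a branch set: inner edges count twice and only the edges
    representing edges at x remain. Conversely an even chain of [e] lifts to representing edges;
    each branch set then has an even number of odd vertices, which can be joined inside it. The
    joins do not change the representing edges. *)
Lemma abstract_dual_minor : abstract_dual e1 D1 ->
  abstract_dual e (fun x y => D1 (m x y).1 (m x y).2).
Proof.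
case=> cutE evenC; split=> [phi x|a [a_sym ae a_even]].
  have -> : \xor_(y | e x y) cut (fun x y => D1 (m x y).1 (m x y).2) phi x y =
            \xor_(y | e x y) cut D1 phi (m x y).1 (m x y).2.
    by apply: eq_bigr => y exy; rewrite /cut (model_rev M exy).
  rewrite -(model_reindex (cut D1 phi)).
  have: \xor_(u | pi u == Some x) \xor_(v | e1 u v) cut D1 phi u v = false.
    by apply: big1 => u _; apply: cutE.
  have E u : pi u == Some x -> \xor_(v | e1 u v) cut D1 phi u v =
     \xor_(v | e1 u v && (pi u == pi v)) cut D1 phi u v (+)
     \xor_(v | e1 u v && (pi u != pi v)) cut D1 phi u v by move=> _; apply: bigID.
  rewrite (eq_bigr _ E) big_split /= => H.
  suff H0 : \xor_(u | pi u == Some x)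
     \xor_(v | e1 u v && (pi u == pi v)) cut D1 phi u v = false by rewrite H0 addFb in H.
  pose a u v := [&& pi u == Some x, pi v == Some x, e1 u v & cut D1 phi u v].
  have a_sym : symmetric a by move=> u v; rewrite /a cut_sym (model_sym1 M) andbCA.
  have a_irr : irreflexive a by move=> u; rewrite /a (model_irr1 M) !andbF.
  apply: etrans (handshake a_sym a_irr).
  rewrite big_mkcond; apply: eq_bigr => u _; rewrite /a.
  case: eqP => [ux|_ /=]; last by rewrite big1.
  rewrite big_mkcond; apply: eq_bigr => v _ /=; rewrite ux eq_sym.
  by case: (e1 u v); case: (_ == _).
pose a1 u v := [exists x, exists y, [&& e x y, a x y & m x y == (u, v)]].
have a1P u v : reflect (exists x y, [/\ e x y, a x y & m x y = (u, v)]) (a1 u v).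
  apply: (iffP existsP) => [[x /existsP[y /and3P[? ? /eqP ?]]]|[x [y [? ? mE]]]].
    by exists x, y.
  by exists x; apply/existsP; exists y; apply/and3P; split=> //; apply/eqP.
have a1_sub u v : a1 u v -> e1 u v && (pi u != pi v).
  case/a1P=> x [y [exy _ mE]]; have [] := model_edge M exy; rewrite mE /= => -> -> -> /=.
  by apply: contraTneq exy => -[->]; rewrite (model_irr M).
have a1_m x y : e x y -> a1 (m x y).1 (m x y).2 = a x y.
  move=> exy; apply/a1P/idP => [[x' [y' [exy' axy']]]|axy]; last by exists x, y; case: (m x y).
  have [_] := model_edge M exy; have [_] := model_edge M exy'.
  by rewrite -surjective_pairing => + + + + mE; rewrite mE => -> -> [<-] [<-].
have a1_sym : symmetric a1.
  have H u v : a1 u v -> a1 v u.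
    case/a1P=> x [y [exy axy mE]]; apply/a1P; exists y, x.
    have [ey] : e y x by apply: ae; rewrite a_sym.
    by rewrite a_sym; split=> //; rewrite (model_rev M exy) mE.
  by move=> u v; apply/idP/idP; apply: H.
pose r := [rel v w | e1 v w && (pi v == pi w)].
have r_sym : symmetric r by move=> u v; rewrite /= (model_sym1 M) eq_sym.
have r_irr : irreflexive r by move=> u; rewrite /= (model_irr1 M).
pose bas u := if pi u is Some x then b x else u.
pose p u := \xor_ v a1 u v.
have p_fibre x : \xor_(u | pi u == Some x) p u = false.
  rewrite -[RHS](a_even x) [RHS](bigID (e x)) /= [X in _ (+) X]big1; last first.
    by move=> y ne; apply/negP => /ae; rewrite (negPf ne).
  rewrite addbF -(eq_bigr _ (fun y exy => a1_m x y exy)) -model_reindex.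
  apply: eq_bigr => u ux; rewrite /p big_mkcond [RHS]big_mkcond; apply: eq_bigr => v _.
  by case: (boolP (a1 u v)) => [/a1_sub->|_]; rewrite ?if_same.
have [|J [J_sym Jr Jrow]] := @join_chain _ r r_sym r_irr p bas.
  move=> u _; rewrite /bas; case ux: (pi u) => [x|]; last exact: connect0.
  exact: (model_fibre M ux).
have [|phi phiE] := evenC (fun u v => a1 u v (+) J u v).
  split=> [u v|u v|u]; first by rewrite a1_sym J_sym.
    by case: (boolP (J u v)) => [/Jr /= /andP[]//|_]; rewrite addbF => /a1_sub/andP[].
  rewrite big_split /= Jrow addbA addbb addFb.
  (* The joins ending at [b x] are as many as the odd vertices in the branch set of x, an even
     number by [p_fibre]. *)
  have E w : p w && (u == bas w) = \xor_ x ((pi w == Some x) && (p w && (u == b x))).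
    rewrite /bas; case wx: (pi w) => [x|]; last first.
      rewrite big1 // (_ : p w = false) // /p big1 // => v _.
      case: (a1P w v) => // -[x [y [exy _ mE]]]; have [_ + _] := model_edge M exy.
      by rewrite mE /= wx.
    rewrite (bigD1 x) //= eqxx big1 ?addbF // => x' /negPf ne.
    by rewrite (_ : (Some x == Some x') = (x == x')) // eq_sym ne.
  rewrite (eq_bigr _ (fun w _ => E w)) exchange_big big1 //= => x _.
  have := xor_andl (fun w => pi w == Some x) (u == b x) p.
  rewrite p_fibre andbF big_mkcond /= => xorE; apply: etrans xorE.
  by apply: eq_bigr => w _; case: eqP => //= _; rewrite andbC.
exists phi => x y exy; have [em m1 m2] := model_edge M exy.
have := phiE _ _ em; rewrite a1_m // (_ : J _ _ = false) ?addbF.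
  by move=> ->; rewrite /cut (model_rev M exy).
apply/negP => /Jr /= /andP[_]; rewrite m1 m2 => /eqP[xy].
by move: exy; rewrite xy (model_irr M).
Qed.

End Minor.

(** * Grids *)

Section Grid.
Variable N : nat.
Local Notation C := ('I_N * 'I_N)%type.
Local Notation F := ('I_N.+1 * 'I_N.+1)%type.

Definition grid : rel C := fun u v =>
  ((u.1 == v.1) && ((u.2.+1 == v.2 :> nat) || (v.2.+1 == u.2 :> nat))) ||
  ((u.2 == v.2) && ((u.1.+1 == v.1 :> nat) || (v.1.+1 == u.1 :> nat))).

Lemma grid_sym : symmetric grid.
Proof.
by move=> u v; rewrite /grid (eq_sym u.1) (eq_sym u.2); congr ((_ && _) || (_ && _)); rewrite orbC.
Qed.

Lemma grid_irr : irreflexive grid.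
Proof. by move=> u; rewrite /grid; lia. Qed.

(* Vertices have coordinates 1 .. N, and [gcell i j] is the unit square with  *)
(* lower left corner (i, j); all the squares sticking out of the grid are     *)
(* identified to a single outer face.                                         *)
Definition gcell (i j : nat) : F :=
  if (0 < i < N) && (0 < j < N) then (inord i, inord j) else (ord0, ord0).

(** The square to the right of the edge directed from [u] to [v]. *)
Definition gside (u v : C) : F :=
  if u.1 == v.1 then if u.2 < v.2 then gcell u.1.+1 u.2.+1 else gcell u.1 v.2.+1
  else if u.1 < v.1 then gcell u.1.+1 u.2 else gcell v.1.+1 u.2.+1.

(** [a] in coordinates starting at 1, extended by [false], so that border vertices also have four
    formal neighbours. *)
Definition gext (a : rel C) (i j i' j' : nat) : bool :=
  [exists p : C * C, [&& a p.1 p.2, p.1.1.+1 == i, p.1.2.+1 == j,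
                         p.2.1.+1 == i' & p.2.2.+1 == j']].

Lemma gextE (a : rel C) (u v : C) : gext a u.1.+1 u.2.+1 v.1.+1 v.2.+1 = a u v.
Proof.
apply/existsP/idP => [[[[u1 u2] [v1 v2]]]|auv]; last by exists (u, v); rewrite /= auv !eqxx.
case: u v => [u1' u2'] [v1' v2'] /= /and5P[+ /eqP[e1] /eqP[e2] /eqP[e3] /eqP[e4]].
by rewrite (val_inj e1) (val_inj e2) (val_inj e3) (val_inj e4).
Qed.

Lemma gext_out (a : rel C) i j i' j' :
  ~~ [&& 0 < i <= N, 0 < j <= N, 0 < i' <= N & 0 < j' <= N] -> gext a i j i' j' = false.
Proof.
move=> out; apply/existsP => -[[[u1 u2] [v1 v2]]] /= /and5P[_ /eqP e1 /eqP e2 /eqP e3 /eqP e4].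
have := (ltn_ord u1, ltn_ord u2, ltn_ord v1, ltn_ord v2) => -[[[]]]; lia.
Qed.

Lemma gext_sym (a : rel C) i j i' j' : symmetric a -> gext a i j i' j' = gext a i' j' i j.
Proof.
move=> a_sym; apply/existsP/existsP => -[[u v] /= /and5P[auv e1 e2 e3 e4]];
by exists (v, u); rewrite /= a_sym auv e1 e2 e3 e4.
Qed.

Lemma gext_row (a : rel C) (u : C) i j :
  \xor_ v (a u v && ((v.1.+1 == i) && (v.2.+1 == j))) = gext a u.1.+1 u.2.+1 i j.
Proof.
case: (boolP ((0 < i <= N) && (0 < j <= N))) => [/andP[iN jN]|out]; last first.
  rewrite gext_out; last by move: out; lia.
  rewrite big1 // => -[v1 v2] _ /=; apply/negP => /and3P[_ /eqP e1 /eqP e2].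
  by move: out (ltn_ord v1) (ltn_ord v2); lia.
have [iN' jN'] : i.-1 < N /\ j.-1 < N by lia.
pose w : C := (Ordinal iN', Ordinal jN').
have [ei ej] : i = w.1.+1 /\ j = w.2.+1 by rewrite /=; lia.
rewrite ei ej gextE -(xor_pred1 w (a u)); apply: eq_bigr => -[v1 v2] _ /=.
by rewrite andbC; congr (_ && _).
Qed.

Lemma grid_row (a : rel C) (u : C) : subrel a grid ->
  \xor_ v a u v = (gext a u.1.+1 u.2.+1 u.1.+2 u.2.+1 (+) gext a u.1.+1 u.2.+1 u.1 u.2.+1) (+)
                  (gext a u.1.+1 u.2.+1 u.1.+1 u.2.+2 (+) gext a u.1.+1 u.2.+1 u.1.+1 u.2).
Proof.
move=> ag; rewrite -!gext_row -!big_split; apply: eq_bigr => v _ /=.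
case: (boolP (a u v)) => //= /ag; rewrite /grid; case: u v => [u1 u2] [v1 v2] /=.
by rewrite -!(inj_eq val_inj) /=; lia.
Qed.

(** The four edges at a vertex separate consecutive squares of the four around it, so a cut is even
    there. Conversely, color a square by the parity of the edges of the even chain crossed by a
    leftward ray: the color changes across vertical edges by construction, across horizontal ones by
    evenness at the vertices. *)
Lemma grid_dual : abstract_dual grid gside.
Proof.
split=> [phi u|a [a_sym ag a_even]].
  pose a (u v : C) := grid u v && cut gside phi u v.
  have ag : subrel a grid by move=> ? ? /andP[].
  have aH i j : 0 < j -> gext a i j i.+1 j = phi (gcell i j) (+) phi (gcell i j.-1).
    move=> j0; case: (boolP ((0 < i < N) && (j <= N))) => [/andP[/andP[i0 iN] jN]|out]; last first.
      rewrite gext_out; last by lia.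
      rewrite /gcell ifF; last by lia.
      by rewrite ifF ?addbb //; lia.
    have [i1 j1] : i.-1 < N /\ j.-1 < N by lia.
    pose u1 : C := (Ordinal i1, Ordinal j1); pose v1 : C := (Ordinal iN, Ordinal j1).
    have -> : gext a i j i.+1 j = a u1 v1 by rewrite -gextE /= !prednK.
    have ne : (u1.1 == v1.1) = false by apply/negP => /eqP[]; lia.
    have lt : u1.1 < v1.1 by rewrite /=; lia.
    have guv : grid u1 v1 by rewrite /grid ne eqxx /= prednK // eqxx.
    rewrite /a guv /cut /gside (eq_sym v1.1) ne lt ltnNge (ltnW lt) /= !prednK //.
    by rewrite addbC.
  have aV i j : 0 < i -> gext a i j i j.+1 = phi (gcell i j) (+) phi (gcell i.-1 j).
    move=> i0; case: (boolP ((0 < j < N) && (i <= N))) => [/andP[/andP[j0 jN] iN]|out]; last first.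
      rewrite gext_out; last by lia.
      rewrite /gcell ifF; last by lia.
      by rewrite ifF ?addbb //; lia.
    have [i1 j1] : i.-1 < N /\ j.-1 < N by lia.
    pose u1 : C := (Ordinal i1, Ordinal j1); pose v1 : C := (Ordinal i1, Ordinal jN).
    have -> : gext a i j i j.+1 = a u1 v1 by rewrite -gextE /= !prednK.
    have lt : u1.2 < v1.2 by rewrite /=; lia.
    have guv : grid u1 v1 by rewrite /grid eqxx /= prednK // eqxx.
    by rewrite /a guv /cut /gside /= !eqxx lt ltnNge (ltnW lt) /= !prednK.
  have {1}-> : \xor_(v | grid u v) cut gside phi u v = \xor_ v a u v by rewrite big_mkcond.
  have as_ : symmetric a by move=> x y; rewrite /a grid_sym cut_sym.
  rewrite grid_row // (gext_sym _ _ u.1) // (gext_sym _ _ _ u.2) //.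
  case: u => [[i iN] [j jN]] /=; rewrite !aH // !aV //=.
  by case: (phi (gcell i.+1 j.+1)) (phi (gcell i.+1 j)) (phi (gcell i j.+1)) (phi (gcell i j)) => [] [] [] [].
pose H i j := gext a i j i.+1 j; pose V i j := gext a i j i j.+1.
have HV i j : 0 < i -> 0 < j -> (H i j (+) H i.-1 j) (+) (V i j (+) V i j.-1) = false.
  move=> i0 j0; case: (boolP ((i <= N) && (j <= N))) => [/andP[iN jN]|out]; last first.
    by rewrite /H /V !gext_out //; lia.
  have [i1 j1] : i.-1 < N /\ j.-1 < N by lia.
  have := a_even (Ordinal i1, Ordinal j1); rewrite grid_row //= !prednK //.
  by rewrite (gext_sym i j i.-1 j a_sym) (gext_sym i j i j.-1 a_sym) /H /V !prednK.
(* The vertical edges at abscissas 1 to i are those met by the leftward ray from the square with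
   lower left corner (i, j). *)
pose psi i j := \big[addb/false]_(0 <= k < i) V k.+1 j.
have psiS i j : psi i.+1 j = psi i j (+) V i.+1 j by rewrite /psi big_nat_recr.
have psiH i j : psi i j.+1 (+) psi i j = H i j.+1.
  elim: i => [|i IH]; first by rewrite /psi !big_geq // /H gext_out.
  have := @HV i.+1 j.+1 isT isT; rewrite /= !psiS -IH.
  by case: (H _ _); case: (psi i _); case: (psi i _); case: (V _ _); case: (V _ _).
(* All outer squares must get one color since they form one face. To the right of the grid this
   follows by climbing from row 0 with [psiH]. *)
have psi_out i j : ~~ ((0 < i < N) && (0 < j < N)) -> psi i j = false.
  rewrite negb_and => /orP[out|out]; last first.
    by rewrite /psi big1 // => k _; rewrite /V gext_out //; lia.
  have [->|iN] : i = 0 \/ N <= i by lia.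
    by rewrite /psi big_geq.
  elim: j => [|j IH]; first by rewrite /psi big1 // => k _; rewrite /V gext_out //; lia.
  by have := psiH i j; rewrite IH addbF => ->; rewrite /H gext_out //; lia.
exists (fun f : F => psi f.1 f.2).
suff H' (u v : C) : grid u v -> a u v = cut gside (fun f : F => psi f.1 f.2) u v by exact: H'.
move=> guv.
have cellE i j : psi (gcell i j).1 (gcell i j).2 = psi i j.
  rewrite /gcell; case: ifP => [ij|/negbT/psi_out->]; last by rewrite /= /psi big_geq.
  by rewrite /= !inordK //; lia.
rewrite /cut -(gextE a).
wlog: u v guv / (u.2 < v.2) || (u.1 < v.1).
  move=> W; case: (boolP ((u.2 < v.2) || (u.1 < v.1))) => [|n]; first exact: W.
  rewrite addbC gext_sym //; apply: W; first by rewrite grid_sym.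
  by move: guv n; rewrite /grid -!(inj_eq val_inj) /=; lia.
move=> lt; rewrite /gside !(eq_sym v.1).
have [uv1|uv1] := eqVneq u.1 v.1.
  have lt2 : u.2 < v.2 by move: lt; rewrite uv1; lia.
  rewrite lt2 ltnNge (ltnW lt2) /= !cellE uv1 psiS.
  have -> : v.2.+1 = u.2.+2 by case/orP: guv => /andP[/eqP e2]; [|move: lt2; rewrite e2]; lia.
  by rewrite /V; case: (psi _ _); case: (gext _ _ _ _ _).
have [uv2 guv1] : u.2 = v.2 /\ (u.1.+1 == v.1 \/ v.1.+1 == u.1).
  by case/orP: guv => /andP[/eqP e2]; [rewrite e2 eqxx in uv1 | move/orP].
have lt1 : u.1 < v.1 by move: lt; rewrite uv2; lia.
rewrite lt1 ltnNge (ltnW lt1) /= !cellE uv2 addbC psiH.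
have -> : v.1.+1 = u.1.+2 by case: guv1; lia.
by [].
Qed.

End Grid.

(** * A drawing in a grid as a minor of the grid *)

Section GridDrawing.
Variables (T : finType) (e : rel T) (N : nat).
Local Notation C := ('I_N * 'I_N)%type.
Variables (B : T -> {set C}) (b : T -> C) (q : T -> T -> C) (s : T -> T -> seq C).

(* [B x] is the set of cells met by the vertex x and the first thirds of the  *)
(* arcs leaving x, and [q x y :: s x y] is a walk of cells along the middle   *)
(* third of the arc xy.                                                       *)
Record grid_drawing : Prop := {
  gd_conn : forall x u, u \in B x ->
    connect [rel v w | [&& @grid N v w, v \in B x & w \in B x]] u (b x) ;
  gd_disj : forall x y u, u \in B x -> u \in B y -> x = y ;
  gd_path : forall x y, e x y -> path (@grid N) (q x y) (s x y) ;
  gd_head : forall x y, e x y -> q x y \in B x ;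
  gd_last : forall x y, e x y -> last (q x y) (s x y) \in B y ;
  gd_avoid : forall x y z u, e x y -> u \in q x y :: s x y -> u \in B z ->
    z = x \/ z = y ;
  gd_cross : forall x y x' y' u, e x y -> e x' y' ->
    u \in q x y :: s x y -> u \in q x' y' :: s x' y' ->
    (x = x' /\ y = y') \/ (x = y' /\ y = x')
}.

Hypotheses (e_sym : symmetric e) (e_irr : irreflexive e) (G : grid_drawing).

(** Orient each edge by [lt]. The walk of xy is cut where it first enters [B y]: what precedes joins
    the branch set of x, and the step into [B y] represents the edge. [e1] keeps the steps between
    cells with equal [pi] and these representing steps. *)
Let lt (x y : T) := enum_rank x < enum_rank y.
Let hit x y := find (mem (B y)) (s x y).
Let prefix x y := q x y :: take (hit x y) (s x y).
Let fibre x (u : C) :=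
  (u \in B x) || [exists y, [&& e x y, lt x y & u \in prefix x y]].
Let pi (u : C) := [pick x | fibre x u].
Let m0 x y := (last (q x y) (take (hit x y) (s x y)), nth (q x y) (s x y) (hit x y)).
Let m x y := if lt x y then m0 x y else ((m0 y x).2, (m0 y x).1).
Let e1 : rel C := fun u v => @grid N u v &&
  ((pi u == pi v) || [exists x, exists y, e x y && (m x y == (u, v))]).

Let lt_total x y : e x y -> lt x y = ~~ lt y x.
Proof.
move=> exy; rewrite /lt; case: ltngtP => // /val_inj/enum_rank_inj xy.
by rewrite xy e_irr in exy.
Qed.

Let prefix_sub x y u : u \in prefix x y -> u \in q x y :: s x y.
Proof. by rewrite !inE => /orP[->//|/mem_take->]; rewrite orbT. Qed.

Let prefix_notin x y u : e x y -> u \in prefix x y -> u \notin B y.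
Proof.
move=> exy; rewrite inE => /orP[/eqP->|ut].
  apply/negP => /(gd_disj G (gd_head G exy)) xy.
  by rewrite xy e_irr in exy.
have /nthP-/(_ u)[i] := ut; rewrite size_take_min leq_min => /andP[ih is_].
rewrite nth_take // => <-.
by have := before_find u ih => /= ->.
Qed.

Let hit_lt x y : e x y -> hit x y < size (s x y).
Proof.
move=> exy; rewrite -has_find; have := gd_last G exy.
case: (s x y) => [|c t] /= L.
  by have := gd_disj G (gd_head G exy) L => xy; rewrite xy e_irr in exy.
by apply/(@hasP _ _ (c :: t)); exists (last c t); rewrite ?mem_last.
Qed.

Let fibre_uniq x x' u : fibre x u -> fibre x' u -> x = x'.
Proof.
case/orP=> [ux|/existsP[y /and3P[exy ltxy up]]].
  case/orP=> [|/existsP[y' /and3P[exy' ltxy' up']]]; first exact: gd_disj.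
  case: (gd_avoid G exy' (prefix_sub up') ux) => // xy'.
  by have := prefix_notin exy' up'; rewrite -xy' ux.
case/orP=> [ux'|/existsP[y' /and3P[exy' ltxy' up']]].
  case: (gd_avoid G exy (prefix_sub up) ux') => // xy'.
  by have := prefix_notin exy up; rewrite -xy' ux'.
case: (gd_cross G exy exy' (prefix_sub up) (prefix_sub up')) => [[]//|[xy yx]].
by move: ltxy ltxy'; rewrite xy yx /lt; lia.
Qed.

Let piE x u : fibre x u -> pi u = Some x.
Proof.
move=> xu; rewrite /pi; case: pickP => [y yu|/(_ x)]; last by rewrite xu.
by rewrite (fibre_uniq xu yu).
Qed.

Let pi_fibre x u : pi u = Some x -> fibre x u.
Proof. by rewrite /pi; case: pickP => [y yu [<-]|_]. Qed.

Let m0_edge x y : e x y -> lt x y ->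
  [/\ @grid N (m0 x y).1 (m0 x y).2, pi (m0 x y).1 = Some x & pi (m0 x y).2 = Some y].
Proof.
move=> exy ltxy; split.
- have := gd_path G exy; rewrite -{1}(cat_take_drop (hit x y) (s x y)) cat_path.
  by rewrite (drop_nth (q x y)) ?hit_lt //= => /and3P[].
- apply: piE; apply/orP; right; apply/existsP; exists y; rewrite exy ltxy /=.
  exact: mem_last.
- apply: piE; apply/orP; left; have := @nth_find _ (q x y) (mem (B y)) (s x y).
  by apply; rewrite has_find hit_lt.
Qed.

Let m_edge x y : e x y ->
  [/\ @grid N (m x y).1 (m x y).2, pi (m x y).1 = Some x & pi (m x y).2 = Some y].
Proof.
move=> exy; rewrite /m; case: (boolP (lt x y)) => [|ltyx]; first exact: m0_edge.
have eyx : e y x by rewrite e_sym.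
have [|? ? ?] := m0_edge eyx; first by rewrite (lt_total eyx).
by split=> //=; rewrite grid_sym.
Qed.

Let m_rev x y : e x y -> m y x = ((m x y).2, (m x y).1).
Proof.
by move=> exy; rewrite /m (lt_total exy); case: (lt y x).
Qed.

Lemma grid_drawing_dual : exists (F : finType) (D : T -> T -> F), abstract_dual e D.
Proof.
have e1_sym : symmetric e1.
  have H u v : e1 u v -> e1 v u.
    case/andP=> guv /orP[/eqP pe|/existsP[x /existsP[y /andP[exy /eqP mE]]]].
      by rewrite /e1 grid_sym guv pe eqxx.
    rewrite /e1 grid_sym guv; apply/orP; right; apply/existsP; exists y; apply/existsP; exists x.
    by rewrite e_sym exy m_rev // mE eqxx.
  by move=> u v; apply/idP/idP; apply: H.
have e1_sub : subrel e1 (@grid N) by move=> u v /andP[].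
have [D1 dual1] := abstract_dual_sub (@grid_sym N) e1_sym e1_sub (grid_dual N).
exists _, (fun x y => D1 (m x y).1 (m x y).2).
apply: (@abstract_dual_minor _ _ _ e1 e D1 pi m b) => //; split=> //.
- by move=> u; rewrite /e1 grid_irr.
- move=> x y exy; have [g m1 m2] := m_edge exy; split=> //.
  rewrite /e1 g; apply/orP; right; apply/existsP; exists x; apply/existsP; exists y.
  by rewrite exy; case: (m x y) => u v /=; rewrite eqxx.
- move=> u v /andP[guv /orP[/eqP//|/existsP[x /existsP[y /andP[exy /eqP mE]]]]] _.
  by exists x, y.
move=> u x /pi_fibre.
set r := [rel v w | _].
have rI v w : fibre x v -> fibre x w -> @grid N v w -> r v w.
  by move=> /piE vx /piE wx g; rewrite /r /= /e1 g vx wx eqxx.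
have conB v : v \in B x -> connect r v (b x).
  move=> /(gd_conn G); apply: connect_sub => {}v w /and3P[g vB wB].
  by apply/connect1/rI; rewrite ?/fibre ?vB ?wB.
case/orP=> [|/existsP[y /and3P[exy ltxy up]]]; first exact: conB.
apply: connect_trans (conB _ (gd_head G exy)).
have r_sym : connect_sym r.
  by apply: sym_connect_sym => v w; rewrite /r /= e1_sym eq_sym.
rewrite r_sym; apply: path_connect up.
have := take_path (hit x y) (gd_path G exy).
apply: (sub_in_path (P := mem (prefix x y))); last by apply/allP.
by move=> v w vp wp; apply: rI; apply/orP; right; apply/existsP; exists y; rewrite exy ltxy.
Qed.

End GridDrawing.

(** * Sampling a drawing *)

Definition within_dist (d : nat) (a a' : nat * nat) : Prop :=
  [/\ a.1 <= a'.1 + d, a'.1 <= a.1 + d, a.2 <= a'.2 + d & a'.2 <= a.2 + d].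

Section SampledDrawing.
Variables (T : finType) (e : rel T) (N n : nat).
Variables (X : T -> T -> nat -> nat * nat) (X0 : T -> nat * nat).

(* [X x y k] is the square of a fine grid containing the k-th of 3n + 1       *)
(* sample points on the arc xy. Squares at distance at most 2 stand for       *)
(* points too close to lie on parts of the drawing that do not meet.          *)
Record sampled_drawing : Prop := {
  sd_bound : forall x y k, e x y -> k <= 3 * n -> (X x y k).1 <= N /\ (X x y k).2 <= N ;
  sd_step : forall x y k, e x y -> k < 3 * n -> within_dist 1 (X x y k) (X x y k.+1) ;
  sd_start : forall x y, e x y -> X x y 0 = X0 x ;
  sd_rev : forall x y k, e x y -> k <= 3 * n -> X y x k = X x y (3 * n - k) ;
  sd_ends : forall x y x' y' k k', e x y -> e x' y' -> k <= n -> k' <= n ->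
    within_dist 2 (X x y k) (X x' y' k') -> x = x' ;
  sd_end_middle : forall x y x' y' k k', e x y -> e x' y' ->
    n <= k <= 2 * n -> k' <= n ->
    within_dist 2 (X x y k) (X x' y' k') -> x' = x \/ x' = y ;
  sd_middles : forall x y x' y' k k', e x y -> e x' y' ->
    n <= k <= 2 * n -> n <= k' <= 2 * n ->
    within_dist 2 (X x y k) (X x' y' k') ->
    (x = x' /\ y = y') \/ (x = y' /\ y = x')
}.

Hypotheses (e_sym : symmetric e) (e_irr : irreflexive e) (S : sampled_drawing).
Local Notation C := ('I_N.+1 * 'I_N.+1)%type.

Let cell (a b : nat) : C := (inord a, inord b).

(* Consecutive squares may touch at a corner only, so a third square is       *)
(* inserted between them.                                                     *)
Let walk (x y : T) (i : nat) := fix walk m : seq C := if m is m'.+1 then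
    [:: cell (X x y (i + m)).1 (X x y (i + m)).2,
        cell (X x y (i + m)).1 (X x y (i + m')).2 & walk m']
  else [:: cell (X x y i).1 (X x y i).2].

Let conn (A : pred C) := connect [rel v w | [&& @grid N.+1 v w, A v & A w]].

Let conn_sub (A A' : pred C) u v : subpred A A' -> conn A u v -> conn A' u v.
Proof.
move=> AA'; apply: connect_sub => {}u {}v /and3P[guv /AA' uA /AA' vA].
by apply: connect1; rewrite /= guv uA.
Qed.

Let conn_step (A : pred C) a b a' b' : a <= N -> b <= N -> a' <= N -> b' <= N ->
  a = a' /\ b <= b'.+1 /\ b' <= b.+1 \/ b = b' /\ a <= a'.+1 /\ a' <= a.+1 ->
  A (cell a b) -> A (cell a' b') -> conn A (cell a b) (cell a' b').
Proof.
move=> aN bN a'N b'N near Aa Ab.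
have [[-> ->]|ne] : (a = a' /\ b = b') \/ (a <> a' \/ b <> b') by lia.
  exact: connect0.
apply: connect1; rewrite /= Aa Ab !andbT /grid /=.
rewrite -!(inj_eq val_inj) /= !inordK ?ltnS //; lia.
Qed.

Let walk_conn x y i m : e x y -> i + m <= 3 * n ->
  forall u, u \in walk x y i m ->
    conn (mem (walk x y i m)) u (cell (X x y i).1 (X x y i).2).
Proof.
move=> exy; elim: m => [_ u|m IH im u].
  by rewrite inE => /eqP->; apply: connect0.
have {}IH := IH (ltnW _); rewrite -addnS in IH; have {}IH := IH im.
pose A : pred C := mem (walk x y i m.+1).
have sub : subpred (mem (walk x y i m)) A by move=> w /= wm; rewrite /A /= !inE wm !orbT.
have imS : i + m < 3 * n by rewrite -addnS.
have [b1 b2] := sd_bound S exy (ltnW imS).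
have [b1' b2'] := sd_bound S exy imS.
have [s1 s2 s3 s4] := sd_step S exy imS.
rewrite -addnS in b1' b2' s1 s2 s3 s4.
have headA : cell (X x y (i + m)).1 (X x y (i + m)).2 \in walk x y i m.
  by case: (m) => [|m'] /=; rewrite ?addn0 !inE eqxx.
have c0 : conn A (cell (X x y (i + m)).1 (X x y (i + m)).2) (cell (X x y i).1 (X x y i).2).
  exact: conn_sub (IH _ headA).
have A1 : A (cell (X x y (i + m.+1)).1 (X x y (i + m.+1)).2) by rewrite /A /= inE eqxx.
have A2 : A (cell (X x y (i + m.+1)).1 (X x y (i + m)).2) by rewrite /A /= !inE eqxx orbT.
have c1 : conn A (cell (X x y (i + m.+1)).1 (X x y (i + m)).2) (cell (X x y i).1 (X x y i).2).
  apply: connect_trans c0; apply: conn_step => //; last exact: sub.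
  by right; lia.
have c2 : conn A (cell (X x y (i + m.+1)).1 (X x y (i + m.+1)).2) (cell (X x y i).1 (X x y i).2).
  by apply: connect_trans c1; apply: conn_step => //; left; lia.
by rewrite /= !inE => /or3P[/eqP->|/eqP->|/IH/conn_sub]; last by apply.
Qed.

Let walk_close x y i m c : e x y -> i + m <= 3 * n -> c \in walk x y i m ->
  exists k, i <= k <= i + m /\ within_dist 1 (nat_of_ord c.1, nat_of_ord c.2) (X x y k).
Proof.
move=> exy; elim: m => [|m IH] im.
  rewrite inE => /eqP->; exists i; split; first lia.
  have [b1 b2] := sd_bound S exy (leq_trans (leq_addr _ _) im).
  by rewrite /= !inordK ?ltnS //; split=> /=; lia.
have imS : i + m < 3 * n by rewrite -addnS.
have [b1 b2] := sd_bound S exy (ltnW imS).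
have [b1' b2'] := sd_bound S exy imS.
have [s1 s2 s3 s4] := sd_step S exy imS.
rewrite -addnS in b1' b2' s1 s2 s3 s4.
rewrite /= !inE => /or3P[/eqP->|/eqP->|/IH].
- by exists (i + m.+1); split; [lia|rewrite /= !inordK ?ltnS //; split=> /=; lia].
- by exists (i + m.+1); split; [lia|rewrite /= !inordK ?ltnS //; split=> /=; lia].
- by case=> [|k [ik kc]]; [lia|exists k; split=> //; lia].
Qed.

(** This accounts for the distance 2 in [sampled_drawing]: two walks sharing a cell both have a
    sample within distance 1 of it. *)
Let near (c : C) (a a' : nat * nat) : within_dist 1 (nat_of_ord c.1, nat_of_ord c.2) a ->
  within_dist 1 (nat_of_ord c.1, nat_of_ord c.2) a' -> within_dist 2 a a'.
Proof. by case=> /= ? ? ? ? [] /= ? ? ? ?; split; lia. Qed.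

Lemma sampled_drawing_dual : exists (F : finType) (D : T -> T -> F), abstract_dual e D.
Proof.
(* The last third of the arc xy is the first third of yx and so belongs to [B y]. *)
pose B x : {set C} := [set c | [exists y, e x y && (c \in walk x y 0 n)]].
have BP x c : reflect (exists2 y, e x y & c \in walk x y 0 n) (c \in B x).
  by rewrite inE; apply: (iffP existsP) => -[y]; [case/andP; exists y|exists y; apply/andP].
pose q x y := cell (X x y n).1 (X x y n).2.
pose q' x y := cell (X x y (n + n)).1 (X x y (n + n)).2.
have headW x y i m : cell (X x y (i + m)).1 (X x y (i + m)).2 \in walk x y i m.
  by case: m => [|m] /=; rewrite ?addn0 !inE eqxx.
have tailW x y i m : cell (X x y i).1 (X x y i).2 \in walk x y i m.
  by elim: m => [|m] /=; rewrite !inE ?eqxx // => ->; rewrite !orbT.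
have /choice[s sP] : forall xy : T * T, exists s : seq C, e xy.1 xy.2 ->
    [/\ path (@grid N.+1) (q xy.1 xy.2) s, last (q xy.1 xy.2) s = q' xy.1 xy.2 &
        {subset q xy.1 xy.2 :: s <= walk xy.1 xy.2 n n}].
  move=> [x y]; case: (boolP (e x y)) => [exy|_]; last by exists [::].
  have n3 : n + n <= 3 * n by lia.
  have := walk_conn exy n3 (headW x y n n).
  have r_sym : connect_sym [rel v w | [&& @grid N.+1 v w, v \in walk x y n n & w \in walk x y n n]].
    by apply: sym_connect_sym => v w /=; rewrite grid_sym; congr (_ && _); rewrite andbC.
  rewrite /conn r_sym => /connectP[s ps ls].
  have qW : q x y \in walk x y n n := tailW x y n n.
  exists s => _; split=> //=; first by apply: sub_path ps => v w /and3P[].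
  move=> c; rewrite inE => /orP[/eqP->//|].
  move: ps; elim: s (cell _ _) {qW ls} => //= v s IH w.
  by case/andP=> /and3P[_ _ vW] ps; rewrite inE => /orP[/eqP->|]; last exact: IH ps.
pose b x := cell (X0 x).1 (X0 x).2.
apply: (@grid_drawing_dual T e N.+1 B b q (fun x y => s (x, y)) e_sym e_irr).
split.
- move=> x u /BP[y exy uw]; have n3 : 0 + n <= 3 * n by lia.
  have := walk_conn exy n3 uw.
  rewrite (sd_start S exy) -/(b x) => /conn_sub; apply.
  by move=> v vw; apply/BP; exists y.
- move=> x x' u /BP[y exy uw] /BP[y' exy' uw'].
  have [|k [kn /near kc]] := walk_close exy _ uw; first lia.
  have [|k' [kn' /kc kc']] := walk_close exy' _ uw'; first lia.
  by apply: (sd_ends S exy exy' _ _ kc'); lia.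
- by move=> x y /(sP (x, y))[].
- by move=> x y exy; apply/BP; exists y => //; apply: (headW x y 0 n).
- move=> x y exy; have [_ -> _] := sP (x, y) exy; apply/BP; exists x; first by rewrite e_sym.
  have := headW y x 0 n; rewrite add0n (sd_rev S exy); last lia.
  by rewrite (_ : 3 * n - n = n + n) //; lia.
- move=> x y z u exy; have [_ _ sub] := sP (x, y) exy => /sub uw /BP[y' ezy uw'].
  have [|k [kn /near kc]] := walk_close exy _ uw; first lia.
  have [|k' [kn' /kc kc']] := walk_close ezy _ uw'; first lia.
  by apply: (sd_end_middle S exy ezy _ _ kc'); lia.
- move=> x y x' y' u exy exy'; have [_ _ sub] := sP (x, y) exy; have [_ _ sub'] := sP (x', y') exy'.
  move=> /sub uw /sub' uw'.
  have [|k [kn /near kc]] := walk_close exy _ uw; first lia.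
  have [|k' [kn' /kc kc']] := walk_close exy' _ uw'; first lia.
  by apply: (sd_middles S exy exy' _ _ kc'); lia.
Qed.

End SampledDrawing.

(** * Cycles and Euler's inequality *)

Section Chains.
Variable T : finType.
Implicit Types (e a b : rel T) (c s : seq T) (x y z : T).

Definition cdeg a x : nat := #|[set y | a x y]|.

Definition csize a : nat := \sum_x \sum_y (a x y && (enum_rank x < enum_rank y)).

Lemma cdegE a x : cdeg a x = \sum_y a x y.
Proof.
rewrite /cdeg -sum1_card [LHS]big_mkcond; apply: eq_bigr => y _.
by rewrite inE; case: (a x y).
Qed.

Lemma odd_cdeg a x : odd (cdeg a x) = \xor_ y a x y.
Proof. by rewrite cdegE (big_morph odd oddD erefl); apply: eq_bigr => y _; rewrite oddb. Qed.

Lemma sum_cdeg a : symmetric a -> irreflexive a -> \sum_x cdeg a x = 2 * csize a.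
Proof.
move=> a_sym a_irr; rewrite mul2n -addnn {2}/csize exchange_big -big_split /=.
apply: eq_bigr => x _; rewrite cdegE -big_split; apply: eq_bigr => y _ /=.
rewrite (a_sym y x); case: ltngtP => [||/val_inj/enum_rank_inj->]; rewrite ?a_irr //; by case: (a x y).
Qed.

Lemma csize_gt0 a x y : symmetric a -> irreflexive a -> a x y -> 0 < csize a.
Proof.
move=> a_sym a_irr axy; rewrite -(ltn_pmul2l (isT : 0 < 2)) muln0 -sum_cdeg //.
rewrite (bigD1 x) //= ltn_addr // card_gt0; apply/set0Pn; exists y.
by rewrite inE.
Qed.

Lemma csizeD a b : (forall x y, b x y -> a x y) ->
  csize a = csize b + csize (fun x y => a x y && ~~ b x y).
Proof.
move=> ba; rewrite /csize -big_split; apply: eq_bigr => x _.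
rewrite -big_split; apply: eq_bigr => y _ /=.
by case: (boolP (b x y)) => [/ba->|_]; rewrite ?andbT //= addn0.
Qed.

Definition cycle_chain c : rel T :=
  fun x y => (x \in c) && ((y == next c x) || (y == prev c x)).

Lemma next_neq_prev c x : uniq c -> 2 < size c -> x \in c -> next c x != prev c x.
Proof.
move=> uc sc xc; apply: contraTneq sc => yE; rewrite -leqNgt.
rewrite -(order_cycle (cycle_next uc) uc xc).
apply: (@order_le_cycle _ _ [:: x; next c x]); last by rewrite inE eqxx.
by rewrite /= eqxx yE next_prev // eqxx.
Qed.

Lemma cycle_chain_sym c : uniq c -> symmetric (cycle_chain c).
Proof.
move=> uc x y; rewrite /cycle_chain; apply/andP/andP => -[zc /orP[]/eqP->];
rewrite ?mem_next ?mem_prev zc ?(next_prev uc) ?(prev_next uc) eqxx ?orbT //.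
Qed.

Lemma cycle_chain_deg c x : uniq c -> 2 < size c -> x \in c -> cdeg (cycle_chain c) x = 2.
Proof.
move=> uc sc xc; rewrite /cdeg (_ : [set y | _] = [set next c x; prev c x]).
  by rewrite cards2 next_neq_prev.
by apply/setP => y; rewrite !inE /cycle_chain xc.
Qed.

Lemma cycle_chain_sub e c : symmetric e -> cycle e c -> subrel (cycle_chain c) e.
Proof.
move=> e_sym ec x y /andP[xc /orP[]/eqP->]; first exact: next_cycle.
by rewrite e_sym prev_cycle.
Qed.

Lemma cycle_chain_even e c : symmetric e -> ucycle e c -> 2 < size c ->
  even_chain e (cycle_chain c).
Proof.
move=> e_sym /andP[ec uc] sc; split; first exact: cycle_chain_sym.
  exact: cycle_chain_sub.
move=> x; rewrite -odd_cdeg; case: (boolP (x \in c)) => xc.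
  by rewrite cycle_chain_deg.
by rewrite /cdeg (_ : [set y | _] = set0) ?cards0 //; apply/setP => y; rewrite !inE /cycle_chain (negPf xc).
Qed.

Lemma csize_cycle e c : symmetric e -> irreflexive e -> ucycle e c -> 2 < size c ->
  csize (cycle_chain c) = size c.
Proof.
move=> e_sym e_irr /andP[ec uc] sc.
have irr : irreflexive (cycle_chain c).
  by move=> x; apply/negP => /(cycle_chain_sub e_sym ec); rewrite e_irr.
apply/eqP; rewrite -(eqn_pmul2l (isT : 0 < 2)) -sum_cdeg //; last exact: cycle_chain_sym.
rewrite (bigID (mem c)) /= [X in _ + X]big1 ?addn0; last first.
  move=> x /negPf xc; apply: eq_card0 => y; rewrite !inE /cycle_chain.
  by rewrite xc.
rewrite (eq_bigr (fun=> 2)) => [|x xc]; last by rewrite cycle_chain_deg.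
by rewrite sum_nat_const mulnC (card_uniqP uc).
Qed.

Lemma even_chain_irr e a : irreflexive e -> even_chain e a -> irreflexive a.
Proof. by move=> e_irr [_ ae _] x; apply/negP => /ae; rewrite e_irr. Qed.

(** If deleting xy separated its ends, y would be the only vertex of odd degree in its component,
    against the handshake lemma. So a path from y to x closes up with xy. *)
Lemma even_chain_cycle e a x y : irreflexive e -> even_chain e a -> a x y ->
  exists c, [/\ 2 < size c, ucycle a c & cycle_chain c x y].
Proof.
move=> e_irr evena axy; have a_irr := even_chain_irr e_irr evena.
have [a_sym _ a_even] := evena.
have xy : x != y by apply: contraTneq axy => ->; rewrite a_irr.
pose d u v := ((u == x) && (v == y)) || ((u == y) && (v == x)).
pose r : rel T := fun u v => a u v && ~~ d u v.
have d_sym : symmetric d by move=> u v; rewrite /d orbC; congr (_ || _); rewrite andbC.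
have r_sym : connect_sym r by apply: sym_connect_sym => u v; rewrite /r a_sym d_sym.
have /connectP[p0 rp0 xE] : connect r y x.
  apply/idPn => nyx; pose K u := connect r y u.
  pose b u v := r u v && (K u && K v).
  have b_sym : symmetric b by move=> u v; rewrite /b /r a_sym d_sym (andbC (K u)).
  have b_irr : irreflexive b by move=> u; rewrite /b /r a_irr.
  have := handshake b_sym b_irr.
  rewrite (eq_bigr (fun u => (u == y) && true)) ?xor_pred1 // => u _; rewrite andbT.
  case: (boolP (K u)) => Ku; last first.
    rewrite big1 => [|v _]; last by rewrite /b (negPf Ku) andbF.
    by apply/esym/negP => /eqP uy; move: Ku; rewrite uy /K connect0.
  have ux : u == x = false by apply: contraNF nyx => /eqP<-.
  suff -> : \xor_ v b u v = (\xor_ v a u v) (+) \xor_ v ((v == x) && (u == y)).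
    by rewrite a_even xor_pred1.
  rewrite -big_split; apply: eq_bigr => v _ /=; rewrite /b Ku /=.
  have -> : r u v && K v = r u v.
    rewrite andb_idr // => ruv; exact: connect_trans Ku (connect1 ruv).
  rewrite /r /d ux /=; case: (boolP (u == y)) => [/eqP uy|_] /=; last by rewrite andbF addbF andbT.
  by case: eqVneq => [->|_] /=; rewrite ?andbF ?andbT ?addbF // uy a_sym axy.
case/shortenP: rp0 xE => p rp up _ xE.
exists (y :: p); have p2 : 2 < size (y :: p).
  case: p rp xE {up} => [|z [|? ?]] //= => [_ xy'|]; first by rewrite xy' eqxx in xy.
  by rewrite andbT /r /d => /andP[_ +] xz; rewrite -xz !eqxx orbT.
have ap : path a y p by apply: sub_path rp => u v /andP[].
split=> //; first by rewrite /ucycle /= rcons_path ap -xE axy.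
rewrite /cycle_chain xE mem_last next_nth mem_last index_last // nth_default //.
by rewrite eqxx.
Qed.

Lemma even_chain_decomp e a x y : symmetric e -> irreflexive e -> even_chain e a -> a x y ->
  exists c, [/\ [/\ 2 < size c, ucycle e c & cycle_chain c x y], subrel (cycle_chain c) a,
    csize a = size c + csize (fun u v => a u v && ~~ cycle_chain c u v) &
    even_chain e (fun u v => a u v && ~~ cycle_chain c u v)].
Proof.
move=> e_sym e_irr evena axy; have [c [sc ac cxy]] := even_chain_cycle e_irr evena axy.
have [a_sym ae a_even] := evena; case/andP: ac => ac uc.
have ca : subrel (cycle_chain c) a by apply: cycle_chain_sub.
have ec : ucycle e c by rewrite /ucycle uc andbT; apply: sub_cycle ac.
exists c; split=> //.
  by rewrite (csizeD ca) (csize_cycle e_sym e_irr ec sc).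
have [c_sym _ c_even] := cycle_chain_even e_sym ec sc.
split=> [u v|u v /andP[/ae]//|u]; first by rewrite a_sym c_sym.
apply: etrans (_ : (\xor_ v a u v) (+) (\xor_ v cycle_chain c u v) = _).
  rewrite -big_split; apply: eq_bigr => v _ /=.
  by case: (boolP (cycle_chain c u v)) => [/ca->|_]; rewrite ?andbT ?addbF.
by rewrite a_even c_even.
Qed.


(** An even chain is an edge-disjoint union of cycles, and two cycles already have 6 edges. *)
Lemma csize_even_chain e a x y : symmetric e -> irreflexive e -> ~ has_cycle e 4 ->
  even_chain e a -> a x y -> 3 <= csize a /\ csize a != 4.
Proof.
move=> e_sym e_irr noC4.
have ge3 b u v : even_chain e b -> b u v -> 3 <= csize b.
  move=> evenb buv; have [c [[sc _ _] _ -> _]] := even_chain_decomp e_sym e_irr evenb buv.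
  exact: leq_trans sc (leq_addr _ _).
move=> evena axy; split; first exact: ge3 axy.
have [c [[sc ec cxy] ca -> evenr]] := even_chain_decomp e_sym e_irr evena axy.
set r := fun u v => _ in evenr *.
have [r0|[u [v /(ge3 _ _ _ evenr) r3]]] : csize r = 0 \/ exists u, exists v, r u v.
- have [/existsP[u /existsP[v ruv]]|none] := boolP [exists u, exists v, r u v].
    by right; exists u, v.
  left; apply: big1 => u _; apply: big1 => v _; case: (boolP (r u v)) => // ruv.
  by case/existsP: none; exists u; apply/existsP; exists v.
- by rewrite r0 addn0; apply/eqP => c4; apply: noC4; exists c.
- lia.
Qed.

Lemma csize0 a : symmetric a -> irreflexive a -> csize a = 0 -> forall x y, a x y = false.
Proof.
move=> a_sym a_irr a0 x y; apply/negP => axy.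
by have := csize_gt0 a_sym a_irr axy; rewrite a0.
Qed.

(** Cycles have length 3 or at least 5, so 7 edges leave room only for one cycle or for two
    triangles. *)
Lemma even_chain_small e a x y : symmetric e -> irreflexive e -> ~ has_cycle e 4 ->
  even_chain e a -> a x y -> csize a <= 7 ->
  exists c, [/\ 2 < size c, ucycle e c, cycle_chain c x y, subrel (cycle_chain c) a &
    (size c = csize a /\ a =2 cycle_chain c) \/ (size c = 3 /\ csize a = 6)].
Proof.
move=> e_sym e_irr noC4 evena axy a7.
have [c [[sc ec cxy] ca aE evenr]] := even_chain_decomp e_sym e_irr evena axy.
exists c; split=> //; move: aE; set r := fun u v => _ in evenr * => aE.
have [r_sym _ _] := evenr.
have r_irr := even_chain_irr e_irr evenr.
have [r0|[u [v ruv]]] : csize r = 0 \/ exists u, exists v, r u v.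
- have [/existsP[u /existsP[v ruv]]|none] := boolP [exists u, exists v, r u v].
    by right; exists u, v.
  left; apply: big1 => u _; apply: big1 => v _; case: (boolP (r u v)) => // ruv.
  by case/existsP: none; exists u; apply/existsP; exists v.
- left; split; first by rewrite aE r0 addn0.
  move=> u v; have := csize0 r_sym r_irr r0 u v; rewrite /r.
  by case: (boolP (cycle_chain c u v)) => [/ca->//|_]; rewrite andbT.
- have [r3 r4] := csize_even_chain e_sym e_irr noC4 evenr ruv.
  have c4 : size c <> 4 by move=> c4; apply: noC4; exists c.
  right; lia.
Qed.

Lemma cycle_chain_rot n c : uniq c -> cycle_chain (rot n c) =2 cycle_chain c.
Proof. by move=> uc x y; rewrite /cycle_chain mem_rot next_rot // prev_rot. Qed.

Lemma cycle_chain_rev c : uniq c -> cycle_chain (rev c) =2 cycle_chain c.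
Proof. by move=> uc x y; rewrite /cycle_chain mem_rev next_rev // prev_rev // orbC. Qed.

Lemma cycle_chain_head x y s v : uniq (x :: y :: s) ->
  cycle_chain (x :: y :: s) x v = (v == y) || (v == last y s).
Proof.
move=> u; set c := [:: x, y & s].
have nx : next c x = y by rewrite /= eqxx.
have nl : next c (last y s) = x.
  rewrite next_nth (mem_last x (y :: s)) (index_last (s := y :: s)) //.
  by rewrite /c /= nth_default.
have px : prev c x = last y s by rewrite -[X in prev _ X]nl prev_next.
by rewrite /cycle_chain nx px inE eqxx.
Qed.

Lemma cycle_chain_orient e c x y : symmetric e -> 2 < size c -> ucycle e c ->
  cycle_chain c x y -> exists s, [/\ ucycle e (x :: y :: s), size (x :: y :: s) = size c &
    cycle_chain (x :: y :: s) =2 cycle_chain c].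
Proof.
move=> e_sym sc /andP[ec uc].
wlog yE : c sc ec uc / y = next c x.
  move=> W cxy; have /andP[xc /orP[]/eqP yE] := cxy; first exact: (W c).
  have [|||||s [u_s s_size sE]] := W (rev c); rewrite ?size_rev ?rev_uniq ?next_rev ?cycle_chain_rev //.
    by rewrite rev_cycle (eq_cycle (e' := e)) // => u v; rewrite e_sym.
  by exists s; split=> //; [rewrite s_size size_rev|move=> u v; rewrite sE cycle_chain_rev].
case/andP=> xc _; have [i s cE] := rot_to xc.
have := yE; rewrite -(next_rot i) // cE.
case: s cE => [|z s] cE; first by move: sc; rewrite -(size_rot i) cE.
rewrite /= eqxx => ->; exists s; split.
- by rewrite -cE /ucycle rot_cycle ec rot_uniq.
- by rewrite -(size_rot i c) cE.
- by move=> u v; rewrite -cE cycle_chain_rot.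
Qed.

End Chains.

(** * Euler's inequality by ranks over F_2 *)

Section Euler.
Import GRing.Theory.
Local Open Scope ring_scope.

Let beta (b : bool) : 'F_2 := b%:R.

Let betaD : {morph beta : b c / b (+) c >-> b + c}.
Proof. by case=> [] []; apply/val_inj. Qed.

Let beta_nz (x : 'F_2) : x = beta (x != 0).
Proof.
case: x => [[|[|n]] lt2] //; by apply/val_inj.
Qed.

Let beta_xor (I : finType) (P : pred I) (b : I -> bool) :
  beta (\xor_(i | P i) b i) = \sum_(i | P i) beta (b i).
Proof. by apply: big_morph; first exact: betaD. Qed.

Let betaM b c : beta (b && c) = beta b * beta c.
Proof. by rewrite /beta -natrM mulnb. Qed.

Variables (T F : finType) (e : rel T) (D : T -> T -> F).
Hypotheses (e_sym : symmetric e) (e_irr : irreflexive e) (dual : abstract_dual e D).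

(** An edge with [f] on both sides is left out: this is the cut of the single face [f], hence an
    even chain. *)
Definition face_bd (f : F) : rel T := fun x y => e x y && ((D x y == f) (+) (D y x == f)).

Lemma face_bd_even f : even_chain e (face_bd f).
Proof.
split=> [x y|x y /andP[]//|x]; first by rewrite /face_bd e_sym addbC.
have := cut_even dual (pred1 f) x; rewrite big_mkcond => bdE; apply: etrans bdE.
by apply: eq_bigr => y _; rewrite /face_bd; case: (e x y).
Qed.

Definition nonempty_faces : {set F} := [set f | (0 < csize (face_bd f))%N].

Let Es := [set p : T * T | e p.1 p.2 && (enum_rank p.1 < enum_rank p.2)%N].

Let card_Es : #|Es| = csize e.
Proof.
rewrite -sum1_card big_mkcond /csize pair_big; apply: eq_bigr => -[x y] _ /=.
by rewrite inE /=; case: (_ && _).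
Qed.

(** Let M be the incidence matrix and N the matrix of face boundaries. Each edge has two ends, so
    the all-one vector is killed by M and M has rank below #|B|. Boundaries sum to zero, so N has
    rank below k if k > 0. The kernel of M consists of even chains, which are sums of boundaries by
    [even_cut]; hence m is at most rank M + rank N. *)
Lemma euler (B : {set T}) : (forall x y, e x y -> x \in B) -> (0 < #|B|)%N ->
  (csize e + 1 + (0 < #|nonempty_faces|) <= #|B| + #|nonempty_faces|)%N.
Proof.
move=> eB B0; rewrite -card_Es; set m := #|Es|; set k := #|_|; set n := #|B|.
pose p (i : 'I_m) : T * T := enum_val i.
have pE i : e (p i).1 (p i).2 /\ (enum_rank (p i).1 < enum_rank (p i).2)%N.
  by have := enum_valP i; rewrite inE => /andP.
pose M : 'M['F_2]_(m, n) := \matrix_(i, j)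
  (beta ((p i).1 == enum_val j) + beta ((p i).2 == enum_val j)).
pose N : 'M['F_2]_(k, m) := \matrix_(f, i) beta (face_bd (enum_val f) (p i).1 (p i).2).
have two (x : 'F_2) : x + x = 0 by rewrite (beta_nz x) -betaD addbb.
have sum_pred1 (I : finType) (A : {set I}) (x : I) (G : I -> 'F_2) : x \in A ->
    \sum_(i in A) beta (x == i) * G i = G x.
  move=> xA; rewrite (bigD1 x) //= eqxx mul1r big1 ?addr0 // => i /andP[_ /negPf].
  by rewrite eq_sym => ->; rewrite mul0r.
have rkM : (\rank M + 1 <= n)%N.
  have M1 : M *m const_mx 1 = 0 :> 'cV_m.
    apply/matrixP => i j; rewrite !mxE.
    under eq_bigr do rewrite !mxE mulr1.
    have [/[dup] ei /eB p1B _] := pE i.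
    have p2B : (p i).2 \in B by apply: (eB _ (p i).1); rewrite e_sym.
    rewrite -(big_enum_val (fun x => beta ((p i).1 == x) + beta ((p i).2 == x))) big_split /=.
    have S x : x \in B -> \sum_(y in B) beta (x == y) = 1.
      move=> xB; rewrite -(sum_pred1 _ B x (fun=> 1) xB); apply: eq_bigr => y _; by rewrite mulr1.
    by rewrite !S // two.
  apply: leq_trans (mulmx0_rank_max M1); rewrite leq_add2l lt0n mxrank_eq0.
  apply/eqP => /matrixP/(_ (Ordinal B0) 0); rewrite !mxE; exact/eqP/oner_neq0.
have bd_out f : f \notin nonempty_faces -> forall x y, face_bd f x y = false.
  rewrite inE -eqn0Ngt => /eqP f0 x y.
  by apply: csize0 f0 _ _; [case: (face_bd_even f)|apply: even_chain_irr (face_bd_even f)].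
have sum_faces (g : F -> bool) x y : e x y ->
    \sum_(f in nonempty_faces) beta (g f) * beta (face_bd f x y) = beta (cut D g x y).
  move=> exy; rewrite big_mkcond (eq_bigr (fun f => beta (D x y == f) * beta (g f) +
     beta (D y x == f) * beta (g f))) => [|f _].
    have S z : \sum_f beta (z == f) * beta (g f) = beta (g z).
      rewrite -(sum_pred1 _ setT z (fun f => beta (g f))) ?inE //.
      by apply: eq_bigl => f; rewrite inE.
    by rewrite big_split /= !S -betaD.
  case: ifPn => [_|/bd_out/(_ x y)]; rewrite /face_bd exy /=.
    by rewrite betaD mulrDr ![beta (g f) * _]mulrC.
  by case: (_ == _); case: (_ == _) => //= _; rewrite ?two // !mul0r addr0.
have rkN : (\rank N + (0 < k) <= k)%N.
  case: (posnP k) => [k0|k0]; first by rewrite addn0 rank_leq_row.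
  have N1 : const_mx 1 *m N = 0 :> 'rV_m.
    apply/matrixP => i j; rewrite !mxE.
    under eq_bigr do rewrite !mxE.
    rewrite -(big_enum_val (fun f => 1 * beta (face_bd f (p j).1 (p j).2))).
    have [ej _] := pE j.
    rewrite (eq_bigr (fun f => beta true * beta (face_bd f (p j).1 (p j).2))) //.
    by rewrite (sum_faces (fun=> true)) // /cut addbb.
  rewrite addnC; apply: leq_trans (mulmx0_rank_max N1); rewrite leq_add2r lt0n mxrank_eq0.
  apply/eqP => /matrixP/(_ 0 (Ordinal k0)); rewrite !mxE; exact/eqP/oner_neq0.
suff kerN : (kermx M <= N)%MS.
  have := mxrankS kerN; rewrite mxrank_ker.
  move: (rank_leq_row M) rkM rkN; lia.
apply/row_subP => r; have := row_sub r (kermx M); move: (row r _) => w {r} /sub_kermxP wM.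
(* The kernel vector [w] is the indicator of an even chain [a]; the face coloring [g] whose cut is
   [a] gives its coefficients on the rows of N. *)
pose nz i := w 0 i != 0.
pose a x y := \xor_ i (nz i && ((p i == (x, y)) (+) (p i == (y, x)))).
have evena : even_chain e a.
  split=> [x y|x y|x]; first by apply: eq_bigr => i _; rewrite addbC.
    apply: contraLR => nexy; rewrite /a big1 // => i _; have [ei _] := pE i.
    case: eqP => [E|_]; first by move: ei nexy; rewrite E /= => ->.
    case: eqP => [E|_]; last by rewrite andbF.
    by move: ei nexy; rewrite E /= e_sym => ->.
  have -> : \xor_ y a x y = \xor_ i (nz i && (((p i).1 == x) (+) ((p i).2 == x))).
    rewrite /a exchange_big; apply: eq_bigr => i _; rewrite xor_andl; congr (_ && _).
    rewrite big_split /=; case: (p i) => u v /=; congr (_ (+) _).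
      rewrite -(xor_pred1 v (fun=> u == x)); apply: eq_bigr => y _.
      by rewrite xpair_eqE andbC (eq_sym y).
    rewrite -(xor_pred1 u (fun=> v == x)); apply: eq_bigr => y _.
    by rewrite xpair_eqE (eq_sym y).
  case: (boolP (x \in B)) => xB; last first.
    rewrite big1 // => i _; have [ei _] := pE i.
    have -> : (p i).1 == x = false by apply: contraNF xB => /eqP<-; apply: eB ei.
    have -> : (p i).2 == x = false by apply: contraNF xB => /eqP<-; rewrite e_sym in ei; apply: eB ei.
    by rewrite andbF.
  suff: beta (\xor_ i (nz i && (((p i).1 == x) (+) ((p i).2 == x)))) = 0 by case: (\xor_ _ _).
  rewrite beta_xor; move/matrixP/(_ 0 (enum_rank_in xB x)): wM; rewrite !mxE => wM.
  apply: etrans wM; apply: eq_bigr => i _; rewrite betaM betaD -beta_nz mxE.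
  by rewrite enum_rankK_in.
have [g gE] := even_cut dual evena.
have a_nz i : a (p i).1 (p i).2 = nz i.
  rewrite /a -[RHS](xor_pred1 i nz); apply: eq_bigr => j _.
  rewrite -surjective_pairing (inj_eq enum_val_inj) andbC; congr (_ && _).
  case: (eqVneq (p j) ((p i).2, (p i).1)) => [E|_]; last by rewrite addbF.
  by have [_] := pE i; have [_] := pE j; rewrite E /=; lia.
have -> : w = (\row_f beta (g (enum_val f))) *m N; last exact: submxMl.
apply/matrixP => r i; rewrite ord1 !mxE (beta_nz (w 0 i)) -/(nz i) -a_nz.
have [ei _] := pE i; rewrite gE // -(sum_faces g) //.
rewrite (big_enum_val (fun f => beta (g f) * beta (face_bd f (p i).1 (p i).2))).
by apply: eq_bigr => f _; rewrite !mxE.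
Qed.

End Euler.

(** * Discharging *)

Ltac break_ands := repeat (case/andP; intro); intro.

Ltac break_uniq U := move: (U); rewrite /= !inE !negb_or -!andbA ?andbT; break_ands.

(** * Short faces and charges in a block without 4-cycles *)

Section Blocks.
Variables (T F : finType) (e : rel T) (D : T -> T -> F) (B : {set T}).
Hypotheses (e_sym : symmetric e) (e_irr : irreflexive e) (dual : abstract_dual e D).
Hypothesis e_in : forall x y, e x y -> x \in B.
Hypothesis conn : forall z x y, z \in B -> x \in B -> y \in B -> x != z -> y != z ->
  connect [rel u v | [&& e u v, u != z & v != z]] x y.
Hypothesis noC4 : ~ has_cycle e 4.

Local Notation dg := (cdeg e).
Local Notation bd := (face_bd e D).

Let edge_neq x y : e x y -> x != y.
Proof. by apply: contraTneq => ->; rewrite e_irr. Qed.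

Ltac edge := first [assumption | by rewrite e_sym | by apply: edge_neq | by rewrite eq_sym; apply: edge_neq |
  by rewrite eq_sym; assumption].

Ltac cyc c := exists c; split=> //; rewrite /ucycle /= ?inE ?negb_or ?andbT;
  repeat (apply/andP; split); edge.

Lemma square_free a b c d : e a b -> e b c -> e c d -> e d a -> a != c -> b != d -> False.
Proof. by move=> ab bc cd da ac bd; apply: noC4; cyc [:: a; b; c; d]. Qed.

Let bd_sub f x y : bd f x y -> e x y.
Proof. by case/andP. Qed.

Let bd_sym f : symmetric (bd f).
Proof. by case: (face_bd_even e_sym dual f). Qed.

Lemma face_bd_second f x y : bd f x y -> exists2 z, z != y & bd f x z.
Proof.
move=> xy; have [/existsP[z /andP[zy xz]]|none] := boolP [exists z, (z != y) && bd f x z].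
  by exists z.
have [_ _ /(_ x)] := face_bd_even e_sym dual f.
rewrite (bigD1 y) //= xy big1 // => z zy; apply/negP => xz.
by case/existsP: none; exists z; rewrite zy.
Qed.

Lemma face_bd_in f x y : bd f x y -> f = D x y \/ f = D y x.
Proof. by case/andP => _; case: eqP => [->|_]; [left|case: eqP => // ->; right]. Qed.

Lemma face_bd_other f x y : bd f x y -> exists2 g, g != f & bd g x y.
Proof.
case/andP => exy; case: (eqVneq (D x y) f) => [xf|nxf] /=.
  by move=> yf; exists (D y x) => //; rewrite /face_bd exy eqxx xf addbT eq_sym.
move=> /eqP yf; exists (D x y) => //.
by rewrite /face_bd exy eqxx yf (eq_sym f) (negPf nxf).
Qed.

Lemma face_bd_two f g h x y : bd f x y -> bd g x y -> f != g -> bd h x y -> h = f \/ h = g.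
Proof.
move=> /face_bd_in fE /face_bd_in gE fg /face_bd_in hE.
by case: fE gE hE fg => -> [] -> [] ->; rewrite ?eqxx; auto.
Qed.

(* A cycle through zb that leaves z by a third edge, not by zc, separates     *)
(* the two sides of zb but not the two sides of zc.                           *)
Lemma edges_not_parallel z b c f g : b != c -> 2 < dg z -> f != g ->
  bd f z b -> bd f z c -> bd g z b -> bd g z c -> False.
Proof.
move=> bc dz fg fb fc gb gc.
have [zb zc] := (bd_sub fb, bd_sub fc).
have [d] : exists d, d \in [set w | e z w] :\ b :\ c.
  apply/set0Pn; rewrite -card_gt0; move: dz; rewrite /cdeg (cardsD1 b) (cardsD1 c).
  by rewrite !inE zb zc (eq_sym c) bc /=; move: #|_|; clear; lia.
rewrite !inE => /and3P[dc db zd].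
have bB : b \in B by apply: (@e_in _ z); rewrite e_sym.
have dB : d \in B by apply: (@e_in _ z); rewrite e_sym.
have bz : b != z by edge.
have dz' : d != z by edge.
have /connectP[p0 pp dE] := conn (e_in zb) bB dB bz dz'.
case/shortenP: pp dE => p pp up _ dE.
have pz : z \notin b :: p.
  rewrite inE negb_or eq_sym bz /=.
  elim: p b pp {up dE bB bz fb gb zb bc db} => //= w p IH v /andP[/and3P[_ _ wz] /IH].
  by rewrite inE negb_or eq_sym wz.
have p_size : 1 < size (b :: p).
  by case: (p) dE => // dE; rewrite dE eqxx in db.
have ec : ucycle e (z :: b :: p).
  rewrite /ucycle /= zb rcons_path -dE (e_sym d) zd andbT.
  move: pz up; rewrite /= => -> /= ->; rewrite !andbT.
  by apply: sub_path pp => u v /and3P[].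
have [phi phiE] := even_cut dual (cycle_chain_even e_sym ec p_size).
have uc : uniq (z :: b :: p) by case/andP: ec.
have := phiE _ _ zb; rewrite cycle_chain_head // eqxx /=.
have := phiE _ _ zc; rewrite cycle_chain_head // -dE !(eq_sym c) (negPf bc) (negPf dc) /=.
have E w : bd f z w -> bd g z w -> cut D phi z w = phi f (+) phi g.
  move=> /face_bd_in fE /face_bd_in gE; rewrite /cut.
  by case: fE gE fg => -> [] ->; rewrite ?eqxx // addbC.
by rewrite !E // => <-.
Qed.

Lemma face_bd_small f x y : bd f x y -> csize (bd f) <= 7 ->
  exists c, [/\ 2 < size c, ucycle e c, cycle_chain c x y, subrel (cycle_chain c) (bd f) &
    (size c = csize (bd f) /\ bd f =2 cycle_chain c) \/ (size c = 3 /\ csize (bd f) = 6)].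
Proof. exact: even_chain_small (face_bd_even e_sym dual f). Qed.

Lemma csize_face f x y : bd f x y -> 3 <= csize (bd f) /\ csize (bd f) != 4.
Proof. exact: csize_even_chain (face_bd_even e_sym dual f). Qed.

Lemma face_cycle f x y : bd f x y -> csize (bd f) = 3 \/ csize (bd f) = 5 ->
  exists s, [/\ ucycle e (x :: y :: s), size (x :: y :: s) = csize (bd f) &
    bd f =2 cycle_chain (x :: y :: s)].
Proof.
move=> xy f35; have [|c [sc ec cxy _ [[cf fc]|]]] := face_bd_small xy; [lia| |lia].
have [s [es s_size sc']] := cycle_chain_orient e_sym sc ec cxy.
by exists s; split=> //; [rewrite s_size|move=> u v; rewrite fc sc'].
Qed.

Definition tri f := csize (bd f) == 3.
Definition pen f := csize (bd f) == 5.

Let rot_row n (c : seq T) x y s v : rot n c = x :: y :: s -> uniq c ->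
  cycle_chain c x v = (v == y) || (v == last y s).
Proof.
by move=> cE uc; rewrite -(cycle_chain_rot n uc) cE cycle_chain_head // -cE rot_uniq.
Qed.

Lemma tri_face f a b : tri f -> bd f a b -> exists c,
  [/\ e b c, e c a, forall v, bd f a v = (v == b) || (v == c),
      forall v, bd f b v = (v == c) || (v == a) & forall v, bd f c v = (v == a) || (v == b)].
Proof.
move=> /eqP f3 fab; have [|s [/andP[es us] ss fE]] := face_cycle fab; first by left.
move: ss es us fE; rewrite f3; case: s => [|c []] //= _ /and4P[ab bc ca _] us fE.
have uc : uniq [:: a; b; c] by [].
exists c; split=> // v; rewrite fE.
- exact: (@rot_row 0 [:: a; b; c] a b [:: c] v erefl uc).
- exact: (@rot_row 1 [:: a; b; c] b c [:: a] v erefl uc).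
- exact: (@rot_row 2 [:: a; b; c] c a [:: b] v erefl uc).
Qed.

Lemma pen_face f a b : pen f -> bd f a b -> exists x y z,
  [/\ uniq [:: a; b; x; y; z], [/\ e b x, e x y, e y z & e z a],
      forall v, bd f a v = (v == b) || (v == z), forall v, bd f b v = (v == x) || (v == a) &
      forall v w, bd f v w -> v \in [:: a; b; x; y; z]].
Proof.
move=> /eqP f5 fab; have [|s [/andP[es us] ss fE]] := face_cycle fab; first by right.
move: ss es us fE; rewrite f5; case: s => [|x [|y [|z []]]] //= _ /and5P[ab bx xy yz /andP[za _]] us fE.
have uc : uniq [:: a; b; x; y; z] by [].
exists x, y, z; split=> // [v|v|v w]; rewrite fE.
- exact: (@rot_row 0 [:: a; b; x; y; z] a b [:: x; y; z] v erefl uc).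
- exact: (@rot_row 1 [:: a; b; x; y; z] b x [:: y; z; a] v erefl uc).
- by case/andP.
Qed.

Definition tri_edge a b := [exists f, tri f && bd f a b].

Lemma tri_edgeP a b : reflect (exists2 f, tri f & bd f a b) (tri_edge a b).
Proof. by apply: (iffP existsP) => -[f]; [case/andP; exists f|exists f; apply/andP]. Qed.

Lemma tri_edge_third a b : tri_edge a b -> exists c, [/\ e a c, e c b & e a b].
Proof.
case/tri_edgeP=> f f3 fab; have [c [bc ca _ _ _]] := tri_face f3 fab.
by exists c; rewrite e_sym ca e_sym bc (bd_sub fab).
Qed.

(** Otherwise the triangle would provide a chord of the 5-cycle, and a chord cuts off a 4-cycle. *)
Lemma third_notin_5cycle v w z x y t : uniq [:: v; w; x; y; t] -> e v w -> e w x -> e x y ->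
  e y t -> e t v -> e v z -> e z w -> z \notin [:: v; w; x; y; t].
Proof.
move=> U vw wx xy yt tv vz zw; break_uniq U.
apply/and5P; split; [by edge|by edge| | |].
- apply/eqP => zx; subst z; apply: (@square_free v x y t) => //; edge.
- apply/eqP => zy; subst z; apply: (@square_free v w x y) => //; edge.
- apply/eqP => zt; subst z; apply: (@square_free w t y x) => //; edge.
Qed.

(** Replace the side vw of the pentagon by the detour over the apex of the triangle. *)
Lemma pen_tri_edge f v w : pen f -> bd f v w -> tri_edge v w -> has_cycle e 6.
Proof.
move=> f5 fvw /tri_edge_third[z [vz zw vw]].
have [x [y [t [U [wx xy yt tv] _ _ _]]]] := pen_face f5 fvw.
have := third_notin_5cycle U vw wx xy yt tv vz zw; rewrite !inE !negb_or; break_ands.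
by break_uniq U; cyc [:: v; z; w; x; y; t].
Qed.

(** Both detours are made at once; a common apex z would give the 4-cycle v, w, z, w'. *)
Lemma pen_tri_edge2 f v w w' : pen f -> w != w' -> bd f v w -> bd f v w' ->
  tri_edge v w -> tri_edge v w' -> has_cycle e 7.
Proof.
move=> f5 ww' fvw fvw' /tri_edge_third[z [vz zw vw]] /tri_edge_third[z' [vz' zw' vw']].
have [x [y [t [U [wx xy yt tv] vrow _ _]]]] := pen_face f5 fvw.
have: w' = t by move: fvw'; rewrite vrow eq_sym (negPf ww') => /eqP.
move=> wt; subst t.
have := third_notin_5cycle U vw wx xy yt tv vz zw; rewrite !inE !negb_or; break_ands.
break_uniq U.
have U' : uniq [:: v; w'; y; x; w].
  by rewrite /= ?inE ?negb_or ?andbT; repeat (apply/andP; split); edge.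
have : z' \notin [:: v; w'; y; x; w] by apply: (third_notin_5cycle U'); edge.
rewrite !inE !negb_or; break_ands.
have zz' : z != z'.
  by apply/eqP => zE; subst z'; apply: (@square_free v w z w') => //; edge.
by cyc [:: v; z; w; x; y; w'; z'].
Qed.

Variable v0 : T.
Hypothesis deg3 : forall v, v \in B -> v != v0 -> 2 < dg v.

Let deg3e x y : e x y -> x != v0 -> 2 < dg x.
Proof. by move/e_in; apply: deg3. Qed.

(** Without 4-cycles both triangles have the same apex, so the faces have the same boundary.
    Distinct faces would contradict [edges_not_parallel] at an end of ab other than v0. *)
Lemma tri_uniq f g a b : tri f -> tri g -> bd f a b -> bd g a b -> f = g.
Proof.
move=> f3 g3 fab gab; have ab := bd_sub fab.
have [c [bc ca fa fb fc]] := tri_face f3 fab.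
have [c' [bc' ca' ga gb gc]] := tri_face g3 gab.
have cc : c' = c.
  apply/eqP/negP => /negP cc; apply: (@square_free a c b c') => //; edge.
subst c'; apply/eqP/negP => /negP fg.
have [av|av] := eqVneq a v0.
  have bv : b != v0 by rewrite -av; edge.
  apply: (@edges_not_parallel b c a f g) => //; rewrite ?fb ?gb ?eqxx ?orbT //;
    first [exact: deg3e bc bv | edge].
apply: (@edges_not_parallel a b c f g) => //; rewrite ?fa ?ga ?eqxx ?orbT //;
  first [exact: deg3e ab av | edge].
Qed.

(** Let c be the apex of [f]. By [edges_not_parallel], [h] contains neither ac nor bc, which
    excludes a triangle through ab, also as one half of a boundary made of two triangles. A hexagon
    becomes a 7-cycle by the detour over c. *)
Lemma tri_neighbour f h a b : ~ has_cycle e 7 -> tri f -> bd f a b -> h != f -> bd h a b ->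
  a != v0 -> b != v0 -> csize (bd h) = 5 \/ 8 <= csize (bd h).
Proof.
move=> noC7 f3 fab hf hab av bv.
have ab := bd_sub fab.
have [c [bc ca fa fb fc]] := tri_face f3 fab.
have nac : bd h a c = false.
  apply/negP => hac; apply: (@edges_not_parallel a b c f h) => //; rewrite ?fa ?eqxx ?orbT //;
    first [exact: deg3e ab av | edge].
have nbc : bd h b c = false.
  apply/negP => hbc; apply: (@edges_not_parallel b c a f h) => //; rewrite ?fb ?eqxx ?orbT //;
    first [exact: deg3e bc bv | edge | by rewrite bd_sym].
have [h8|h7] := ltnP 7 (csize (bd h)); [by right|left].
have [c0 [sc0 ec0 cab sub hE]] := face_bd_small hab h7.
have [s [/andP[es us] ss sE]] := cycle_chain_orient e_sym sc0 ec0 cab.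
have sub' u v : cycle_chain [:: a, b & s] u v -> bd h u v by rewrite sE; apply: sub.
have last_a : bd h a (last b s) by apply: sub'; rewrite cycle_chain_head ?eqxx ?orbT.
have not3 : size c0 <> 3.
  move=> c3; move: ss es us last_a; rewrite c3; case: (s) => [|z []] //= _.
  case/and4P=> _ bz za _ us haz.
  have zc : z = c.
    apply/eqP/negP => /negP zc; apply: (@square_free a z b c) => //; edge.
  by move: haz; rewrite zc nac.
have [h3 h4] := csize_face hab.
have not7 : csize (bd h) <> 7.
  move=> h7'; case: hE => [[c7 _]|[_ h6]]; last by rewrite h6 in h7'.
  by apply: noC7; exists c0; split=> //; rewrite c7.
have not6 : csize (bd h) <> 6; last first.
  case: hE => [[cE _]|[c3 _]]; last by case: not3.
  move: h3 h4 h7 not3 not7 not6; rewrite -cE; clear; case: (size c0) => [|[|[|[|[|[|[|[|k]]]]]]]] //=.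
move=> h6; have c6 : size c0 = 6 by case: hE => [[-> _]|[]].
move: ss es us last_a sub'; rewrite c6.
case: (s) => [|x [|y [|z [|t []]]]] //= _ /and5P[_ bx xy yz /and3P[zt ta _]] us hat sub'.
have hbx : bd h b x.
  apply: sub'; have uc : uniq [:: a; b; x; y; z; t] by [].
  by rewrite (@rot_row 1 [:: a; b; x; y; z; t] b x [:: y; z; t; a] x erefl uc) eqxx.
have U : uniq [:: a; b; x; y; z; t] by [].
break_uniq U.
have xc : x != c by apply: contraTneq hbx => ->; rewrite nbc.
have tc : t != c by apply: contraTneq hat => ->; rewrite nac.
have yc : y != c.
  apply/eqP => yc; subst y; apply: (@square_free a b x c) => //; edge.
have zc : z != c.
  apply/eqP => zc; subst z; apply: (@square_free b c t a) => //; edge.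
by apply: noC7; cyc [:: a; c; b; x; y; z; t].
Qed.

Definition on_face f v := [exists w, bd f v w].

Lemma on_faceP f v : reflect (exists w, bd f v w) (on_face f v).
Proof. exact: existsP. Qed.

(** Let d be the third neighbour of a. If d is not v0 and the faces across ab and ac are shorter
    than 8, they are pentagons d a b y x and d a c w u, and d, x, y, b, c, w, u is a 7-cycle. *)
Lemma big_face_near_tri f a b c : ~ has_cycle e 7 -> tri f -> bd f a b -> bd f a c -> b != c ->
  dg a = 3 -> a != v0 -> b != v0 -> c != v0 ->
  e a v0 \/ exists2 h, 8 <= csize (bd h) & on_face h a.
Proof.
move=> noC7 f3 fab fac bc_neq a3 av bv cv.
have [ab ac] := (bd_sub fab, bd_sub fac).
have [c' [bc ca fa fb fc]] := tri_face f3 fab.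
have cc : c' = c by move: fac; rewrite fa eq_sym (negPf bc_neq) => /eqP.
subst c'.
have [d [ad db dc dE]] : exists d, [/\ e a d, d != b, d != c &
    forall w, e a w -> [|| w == b, w == c | w == d]].
  move: a3; rewrite /cdeg (cardsD1 b) (cardsD1 c) !inE ab ac (eq_sym c) bc_neq /= => -[].
  move=> /eqP/cards1P[d /setP dE]; exists d; have := dE d.
  rewrite !inE eqxx => /and3P[dc db ad]; split=> // w aw; have := dE w; rewrite !inE aw andbT.
  by case: (w == b); case: (w == c) => //= ->.
have [dv|dv] := eqVneq d v0; [by left; rewrite -dv|right].
have [h1 h1f h1b] := face_bd_other fab; have [h2 h2f h2c] := face_bd_other fac.
have da : 2 < dg a by rewrite a3.
have h12 : h1 != h2.
  apply/eqP => hE; subst h2; apply: (@edges_not_parallel a b c f h1) => //; edge.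
have h1c : bd h1 a c = false.
  apply/negP => h1c; case: (face_bd_two fac h2c _ h1c); rewrite 1?eq_sym // => hE; subst h1.
    by rewrite eqxx in h1f.
  by rewrite eqxx in h12.
have h2b : bd h2 a b = false.
  apply/negP => h2b; case: (face_bd_two fab h1b _ h2b); rewrite 1?eq_sym // => hE; subst h2.
    by rewrite eqxx in h2f.
  by rewrite eqxx in h12.
have h1d : bd h1 a d.
  have [w wb h1w] := face_bd_second h1b; have := dE w (bd_sub h1w).
  by rewrite (negPf wb) /= => /orP[]/eqP wE; move: h1w; rewrite wE // h1c.
have h2d : bd h2 a d.
  have [w wc h2w] := face_bd_second h2c; have := dE w (bd_sub h2w).
  by rewrite (negPf wc) /= => /orP[]/eqP wE; move: h2w; rewrite wE // h2b.
have [h15|h18] := tri_neighbour noC7 f3 fab h1f h1b av bv; last first.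
  by exists h1 => //; apply/on_faceP; exists d.
have [h25|h28] := tri_neighbour noC7 f3 fac h2f h2c av cv; last first.
  by exists h2 => //; apply/on_faceP; exists d.
exfalso; move/eqP: h15 => h15; move/eqP: h25 => h25.
rewrite bd_sym in h1d; rewrite bd_sym in h2d.
have [b' [y [x [U [ab' by_ yx xd] h1row h1row' _]]]] := pen_face h15 h1d.
have [c' [w [u [U' [ac' cw wu ud] h2row h2row' _]]]] := pen_face h25 h2d.
have bE : b' = b by move: h1b; rewrite h1row' (eq_sym b d) (negPf db) orbF => /eqP.
have cE : c' = c by move: h2c; rewrite h2row' (eq_sym c d) (negPf dc) orbF => /eqP.
subst b' c'; break_uniq U; break_uniq U'.
have h1x : bd h1 d x by rewrite h1row eqxx orbT.
have h2u : bd h2 d u by rewrite h2row eqxx orbT.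
have dd : 2 < dg d by apply: (deg3e (y := a)) dv; edge.
have yc : y != c.
  apply/eqP => yc; subst y; apply: (@square_free a c x d) => //; edge.
have xc : x != c.
  apply/eqP => xc; subst x; apply: (@square_free a b y c) => //; edge.
have wb : w != b.
  apply/eqP => wb; subst w; apply: (@square_free a b u d) => //; edge.
have ub : u != b.
  apply/eqP => ub; subst u; apply: (@square_free a c w b) => //; edge.
have xu : x != u.
  apply/eqP => xu; subst u; apply: (@edges_not_parallel d a x h1 h2) => //; first [edge | by rewrite bd_sym].
have xw : x != w.
  apply/eqP => xw; subst w; apply: (@square_free a d x c) => //; edge.
have yu : y != u.
  apply/eqP => yu; subst u; apply: (@square_free a b y d) => //; edge.
have yw : y != w.
  apply/eqP => yw; subst w; apply: (@square_free a b y c) => //; edge.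
by apply: noC7; cyc [:: d; x; y; b; c; w; u].
Qed.


Lemma pen_cycle f a b : pen f -> bd f a b -> exists x y z,
  [/\ uniq [:: a; b; x; y; z], [/\ e a b, e b x, e x y, e y z & e z a] &
      all (on_face f) [:: a; b; x; y; z]].
Proof.
move=> /eqP f5 fab; have [|s [/andP[es us] ss fE]] := face_cycle fab; first by right.
move: ss es us fE; rewrite f5; case: s => [|x [|y [|z []]]] //= _ /and5P[ab bx xy yz /andP[za _]] us fE.
have uc : uniq [:: a; b; x; y; z] by [].
exists x, y, z; split=> //; rewrite andbT; apply/and5P; split; apply/on_faceP.
- by exists b.
- by exists x; rewrite fE (@rot_row 1 [:: a; b; x; y; z] b x [:: y; z; a] x erefl uc) eqxx.
- by exists y; rewrite fE (@rot_row 2 [:: a; b; x; y; z] x y [:: z; a; b] y erefl uc) eqxx.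
- by exists z; rewrite fE (@rot_row 3 [:: a; b; x; y; z] y z [:: a; b; x] z erefl uc) eqxx.
- by exists a; rewrite fE (@rot_row 4 [:: a; b; x; y; z] z a [:: b; x; y] a erefl uc) eqxx.
Qed.

Lemma pen_has_cycle f a b : pen f -> bd f a b -> has_cycle e 5.
Proof.
move=> f5 /(pen_cycle f5)[x [y [z [U [ab bx xy yz za] _]]]].
by exists [:: a; b; x; y; z]; split=> //; rewrite /ucycle U /= ab bx xy yz za.
Qed.

Definition tau v := #|[set f | tri f && on_face f v]|.
Definition pens v := #|[set f | pen f && on_face f v]|.

Lemma cdeg_on_face f v : on_face f v -> 2 <= cdeg (bd f) v.
Proof.
case/on_faceP=> w vw; have [z zw vz] := face_bd_second vw.
rewrite /cdeg (cardsD1 w) inE vw (cardsD1 z) !inE vz zw; lia.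
Qed.

Lemma card_faces_edge v w : #|[set f | bd f v w]| <= 2 * e v w.
Proof.
case: (boolP (e v w)) => vw; last first.
  rewrite muln0 leqn0 cards_eq0; apply/eqP/setP => f; rewrite !inE; apply/negP => /bd_sub.
  exact/negP.
apply: (@leq_trans #|[set D v w; D w v]|); last by rewrite cards2; case: (_ != _).
apply/subset_leq_card/subsetP => f; rewrite !inE => /face_bd_in[]->; rewrite eqxx ?orbT //.
Qed.

Lemma sum_cdeg_faces (P : pred F) v :
  \sum_(f | P f) cdeg (bd f) v = \sum_w #|[set f | P f && bd f v w]|.
Proof.
under eq_bigr do rewrite cdegE; rewrite exchange_big; apply: eq_bigr => w _ /=.
rewrite -sum1_card [RHS]big_mkcond [LHS]big_mkcond; apply: eq_bigr => f _ /=.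
by rewrite inE; case: (P f); case: (bd f v w).
Qed.

Lemma sum_cdeg_faces_le (P : pred F) v : \sum_(f | P f) cdeg (bd f) v <= 2 * dg v.
Proof.
rewrite sum_cdeg_faces cdegE big_distrr; apply: leq_sum => w _ /=.
apply: leq_trans (card_faces_edge v w); apply/subset_leq_card/subsetP => f.
by rewrite !inE => /andP[].
Qed.

Lemma sum_csize_faces : \sum_f csize (bd f) <= 2 * csize e.
Proof.
rewrite -(leq_pmul2l (isT : 0 < 2)) big_distrr /= -(sum_cdeg e_sym e_irr).
rewrite (eq_bigr (fun f => \sum_v cdeg (bd f) v)) => [|f _]; last first.
  by rewrite sum_cdeg //; apply: even_chain_irr (face_bd_even e_sym dual f).
rewrite exchange_big big_distrr; apply: leq_sum => v _; exact: sum_cdeg_faces_le.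
Qed.

(** The edges at v have 2 (dg v) sides, and each face at v takes at least two of them. *)
Lemma tau_pens v : tau v + pens v <= dg v.
Proof.
rewrite -(leq_pmul2l (isT : 0 < 2)).
apply: leq_trans (sum_cdeg_faces_le (fun f => (tri f || pen f) && on_face f v) v).
apply: (@leq_trans (\sum_(f | (tri f || pen f) && on_face f v) 2)); last first.
  by apply: leq_sum => f /andP[_]; apply: cdeg_on_face.
rewrite sum_nat_const mulnC leq_pmul2r // /tau /pens -cardsUI (_ : _ :&: _ = set0) ?cards0 ?addn0.
  by apply/subset_leq_card/subsetP => f; rewrite !inE unfold_in -andb_orl.
by apply/setP => f; rewrite !inE /tri /pen; case: eqP => // ->; rewrite andbF.
Qed.

(** Each triangular face has two edges at v, and by [tri_uniq] they are not shared. *)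
Lemma tau_tri_edges v : 2 * tau v <= #|[set w | tri_edge v w]|.
Proof.
apply: (@leq_trans (\sum_(f | tri f && on_face f v) cdeg (bd f) v)).
  rewrite /tau mulnC -sum_nat_const; rewrite (eq_bigl (fun f => tri f && on_face f v)) => [|f].
    by apply: leq_sum => f /andP[_]; apply: cdeg_on_face.
  by rewrite inE.
rewrite sum_cdeg_faces -sum1_card big_mkcond; rewrite [leqRHS]big_mkcond /=.
apply: leq_sum => w _; rewrite inE; case: ifPn => [_|none].
  apply/card_le1_eqP => f g; rewrite !inE => /andP[/andP[f3 _] fw] /andP[/andP[g3 _] gw].
  exact: tri_uniq g3 f3 gw fw.
rewrite leqn0 cards_eq0; apply/eqP/setP => f; rewrite !inE; apply/negP => /andP[/andP[f3 _] fw].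
by case/tri_edgeP: none; exists f.
Qed.

Lemma tri_edge_sub v w : tri_edge v w -> e v w.
Proof. by case/tri_edgeP => f _ /bd_sub. Qed.

(** At most dg v - 2 (tau v) edges at v avoid the triangular faces, and each of them lies on at most
    two pentagonal faces. *)
Lemma pens_free q v : (forall f, pen f -> on_face f v ->
    q <= #|[set w | bd f v w && ~~ tri_edge v w]|) ->
  q * pens v <= 2 * (dg v - 2 * tau v) /\ (0 < pens v -> q <= dg v - 2 * tau v).
Proof.
move=> qP; have W2 := tau_tri_edges v.
have WE : #|[set w | e v w && ~~ tri_edge v w]| + #|[set w | tri_edge v w]| = dg v.
  rewrite /cdeg -cardsUI (_ : _ :&: _ = set0) ?cards0 ?addn0.
    apply: eq_card => w; rewrite !inE; case: (boolP (tri_edge v w)) => [/tri_edge_sub->|_] //.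
    by rewrite andbT orbF.
  by apply/setP => w; rewrite !inE -andbA andNb andbF.
split; last first.
  rewrite card_gt0 => /set0Pn[f]; rewrite inE => /andP[f5 fv].
  apply: leq_trans (qP f f5 fv) _; rewrite -WE.
  have := subset_leq_card (_ : [set w | bd f v w && ~~ tri_edge v w] \subset
     [set w | e v w && ~~ tri_edge v w]).
  move/(_ _)/leq_trans; apply; last by clear -W2; lia.
  by apply/subsetP => w; rewrite !inE => /andP[/bd_sub-> ->].
apply: (@leq_trans (2 * #|[set w | e v w && ~~ tri_edge v w]|)); last by clear -W2 WE; lia.
apply: (@leq_trans (\sum_(f | pen f && on_face f v) #|[set w | bd f v w && ~~ tri_edge v w]|)).
  rewrite /pens mulnC -sum_nat_const (eq_bigl (fun f => pen f && on_face f v)) => [|f].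
    by apply: leq_sum => f /andP[? ?]; apply: qP.
  by rewrite inE.
have -> : \sum_(f | pen f && on_face f v) #|[set w | bd f v w && ~~ tri_edge v w]| =
   \sum_(w | ~~ tri_edge v w) #|[set f | pen f && on_face f v && bd f v w]|.
  have E f : #|[set w | bd f v w && ~~ tri_edge v w]| = \sum_(w | ~~ tri_edge v w) bd f v w.
    rewrite -sum1_card [RHS]big_mkcond [LHS]big_mkcond; apply: eq_bigr => w _.
    by rewrite inE; case: (bd f v w); case: (tri_edge v w).
  under eq_bigr do rewrite E; rewrite exchange_big; apply: eq_bigr => w _ /=.
  rewrite -sum1_card [RHS]big_mkcond [LHS]big_mkcond; apply: eq_bigr => f _ /=.
  by rewrite inE; case: (_ && _); case: (bd f v w).
rewrite mulnC -sum_nat_const big_mkcond [leqRHS]big_mkcond; apply: leq_sum => w _ /=.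
rewrite inE andbC; case: (tri_edge v w) => //=.
have -> : (if e v w then 2 else 0) = 2 * e v w by case: (e v w).
apply: leq_trans (card_faces_edge v w); apply/subset_leq_card/subsetP => f.
by rewrite !inE => /andP[].
Qed.

(** [seven] stands for l = 7. The cases l = 5 and l = 6 are treated together: not both lengths
    occur. *)
Variable seven : bool.
Hypothesis forbidden : if seven then ~ has_cycle e 7 else ~ (has_cycle e 5 /\ has_cycle e 6).

Lemma pen_free_edges f v : pen f -> on_face f v ->
  (if seven then 1 else 2) <= #|[set w | bd f v w && ~~ tri_edge v w]|.
Proof.
move=> f5 /on_faceP[w vw]; have [z zw vz] := face_bd_second vw.
case: seven forbidden => noC.
  rewrite card_gt0; apply/set0Pn.
  case: (boolP (tri_edge v w)) => tw; last by exists w; rewrite inE vw.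
  exists z; rewrite inE vz; apply/negP => tz; apply: noC.
  exact: (pen_tri_edge2 f5 zw vz vw tz tw).
have nt u : bd f v u -> ~~ tri_edge v u.
  move=> vu; apply/negP => tu; apply: noC; split; first exact: pen_has_cycle f5 vu.
  exact: pen_tri_edge f5 vu tu.
by rewrite (cardsD1 w) inE vw nt // (cardsD1 z) !inE vz zw nt //; clear; lia.
Qed.

Hypothesis v0B : v0 \in B.
Hypothesis B_gt1 : 1 < #|B|.
Hypothesis adj3 : forall u v, e u v -> u != v0 -> v != v0 -> dg u = 3 -> dg v = 3 -> False.
Hypothesis tri344 : forall a b c, e a b -> e b c -> e c a ->
  a != v0 -> b != v0 -> c != v0 -> dg a = 3 -> dg b = 4 -> dg c = 4 -> False.

(* Up to a factor 3, a vertex v has charge 2 (dg v) - 6 and a face of length  *)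
(* n has charge n - 6. [tri_gift v] and [pen_gift v] are what v gives to each *)
(* triangular and to each pentagonal face at v.                               *)
Definition tri_gift v :=
  if v == v0 then 6 else if dg v == 3 then 0 else if dg v == 4 then 3 else if seven then 5 else 6.

Definition pen_gift v := if v == v0 then 3 else if dg v == 3 then 0 else 1.

Definition small v := (v != v0) && (dg v == 3).

Let gift_arith (d t n : nat) : 2 < d -> t + n <= d -> 2 * t <= d ->
  (if seven then 1 else 2) * n <= 2 * (d - 2 * t) ->
  (0 < n -> (if seven then 1 else 2) <= d - 2 * t) ->
  (if d == 3 then 0 else if d == 4 then 3 else if seven then 5 else 6) * t +
  (if d == 3 then 0 else 1) * n + 18 <= 6 * d.
Proof.
clear; case: seven => /= d2 tn td nd n0.
- case: eqP => [->|d3] //; case: eqP => [d4|d4]; first by subst d; lia.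
  have [dE|d6] : d = 5 \/ 5 < d by lia.
    subst d; have tc : t = 0 \/ t = 1 \/ t = 2 \/ 2 < t by lia.
    by case: tc => [tE|[tE|[tE|t3]]]; try subst t; lia.
  lia.
- case: eqP => [->|d3] //; case: eqP => [d4|d4]; first by subst d; lia.
  have [dE|d6] : d = 5 \/ 5 < d by lia.
    subst d; have tc : t = 0 \/ t = 1 \/ t = 2 \/ 2 < t by lia.
    by case: tc => [tE|[tE|[tE|t3]]]; try subst t; lia.
  lia.
Qed.

Lemma vertex_gifts v : v \in B -> v != v0 ->
  tri_gift v * tau v + pen_gift v * pens v + 18 <= 6 * dg v.
Proof.
move=> vB vv0; rewrite /tri_gift /pen_gift (negPf vv0).
have tW := tau_tri_edges v.
have td : 2 * tau v <= dg v.
  apply: leq_trans tW _; apply/subset_leq_card/subsetP => w; rewrite !inE; exact: tri_edge_sub.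
have [qn n0] := pens_free (fun f => @pen_free_edges f v).
exact: gift_arith (deg3 vB vv0) (tau_pens v) td qn n0.
Qed.

(** Unlike in [vertex_gifts] there is no summand 18: v0 may end with charge -18, which the total of
    at most -36 allows. The summand [dg v0] on the left pays for the root links. *)
Lemma root_gifts : tri_gift v0 * tau v0 + pen_gift v0 * pens v0 + dg v0 <= 6 * dg v0.
Proof.
have tW := tau_tri_edges v0; have tp := tau_pens v0.
have td : 2 * tau v0 <= dg v0.
  apply: leq_trans tW _; apply/subset_leq_card/subsetP => w; rewrite !inE; exact: tri_edge_sub.
rewrite /tri_gift /pen_gift eqxx; move: (tau v0) (pens v0) (dg v0) tp td; clear; lia.
Qed.

Lemma tau_small v : small v -> tau v <= 1.
Proof.
case/andP=> _ /eqP d3; have tW := tau_tri_edges v.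
have td : #|[set w | tri_edge v w]| <= dg v.
  apply/subset_leq_card/subsetP => w; rewrite !inE; exact: tri_edge_sub.
rewrite d3 in td; move: (tau v) #|_| tW td; clear; lia.
Qed.

Let sum_on (f : F) (G : T -> nat) (s : seq T) : uniq s -> all (on_face f) s ->
  \sum_(v <- s) G v <= \sum_(v | on_face f v) G v.
Proof.
move=> us /allP sf; rewrite big_uniq // big_mkcond [leqRHS]big_mkcond.
by apply: leq_sum => v _; case: (boolP (v \in s)) => // /sf ->.
Qed.

(* A triangular face moreover gets 1 from v0 for each vertex of degree 3      *)
(* adjacent to v0, and 1 from each face of length at least 8 for each common  *)
(* vertex of degree 3. This is only needed when 7-cycles are forbidden.       *)
Definition root_links f := #|[set a | [&& on_face f a, small a & e a v0]]|.

Definition big_links f :=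
  #|[set x : F * T | [&& 8 <= csize (bd x.1), on_face x.1 x.2, on_face f x.2 & small x.2]]|.

Let tri_cycle f a : tri f -> on_face f a -> exists b c,
  [/\ uniq [:: a; b; c], [/\ e a b, e b c & e c a], bd f a b, bd f a c &
      all (on_face f) [:: a; b; c]].
Proof.
move=> f3 /on_faceP[b fab]; have [c [bc ca fa fb fc]] := tri_face f3 fab.
exists b, c; have ab := bd_sub fab.
split=> //; last 1 first.
- rewrite /= andbT; apply/and3P; split; apply/on_faceP; [exists b|exists c|exists a] => //.
    by rewrite fb eqxx.
  by rewrite fc eqxx.
- by rewrite /= !inE !negb_or !andbT; repeat (apply/andP; split); edge.
- by rewrite fa eqxx orbT.
Qed.

(** At v0 a triangle gets 6, and 3 more since its other two vertices are not both of degree 3. Away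
    from v0, degrees at least 4 give 3 each. With one vertex of degree 3 the others are not both of
    degree 4 and give 3 + 6, or 3 + 5 if [seven], when [big_face_near_tri] supplies a link. *)
Lemma tri_receives f : tri f ->
  9 <= \sum_(v | on_face f v) tri_gift v + root_links f + big_links f.
Proof.
move=> f3.
have [v0f|v0f] := boolP (on_face f v0).
  have [b [c [U [ab bc ca] _ _ onf]]] := tri_cycle f3 v0f.
  apply: leq_trans (leq_addr _ _); apply: leq_trans (leq_addr _ _).
  apply: leq_trans (sum_on tri_gift U onf); rewrite !big_cons big_nil /tri_gift eqxx.
  have bv : b != v0 by edge.
  have cv : c != v0 by edge.
  rewrite (negPf bv) (negPf cv).
  have d3 := @adj3 _ _ bc bv cv.
  case: eqP => b3; case: eqP => c3; first by case: d3.
  - by clear; case: ifP => _; [|case: seven].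
  - by clear; case: ifP => _; [|case: seven].
  - by clear; case: ifP => _; [|case: seven]; case: ifP => _; try case: seven.
have nv0 v : on_face f v -> v != v0 by move=> fv; apply: contraNneq v0f => <-.
have onB v : on_face f v -> v \in B by case/on_faceP => w /bd_sub/e_in.
have [/existsP[a /andP[fa /eqP a3]]|no3] := boolP [exists a, on_face f a && (dg a == 3)].
  have [b [c [U [ab bc ca] fab fac onf]]] := tri_cycle f3 fa.
  have /and4P[_ fb fc _] := onf.
  have [[av bv] cv] := (nv0 _ fa, nv0 _ fb, nv0 _ fc).
  have sumle := sum_on tri_gift U onf.
  have b3 : dg b <> 3 by move=> b3; apply: (adj3 ab).
  have c3 : dg c <> 3 by move=> c3; apply: (adj3 (_ : e c a)).
  have bc4 : ~ (dg b = 4 /\ dg c = 4) by case=> b4 c4; apply: (tri344 ab bc ca).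
  have gE v : v != v0 -> dg v <> 3 ->
      tri_gift v = if dg v == 4 then 3 else if seven then 5 else 6.
    by move=> vv /eqP/negPf v3; rewrite /tri_gift (negPf vv) v3.
  have ga : tri_gift a = 0 by rewrite /tri_gift (negPf av) a3.
  rewrite !big_cons big_nil ga (gE b) // (gE c) // in sumle.
  have S : 8 + ~~ seven <= 0 + ((if dg b == 4 then 3 else if seven then 5 else 6) +
       ((if dg c == 4 then 3 else if seven then 5 else 6) + 0)).
    by move: bc4; clear; case: eqP; case: eqP; case: seven => //; intuition.
  have {}sumle := leq_trans S sumle.
  have [s7|s7] := boolP seven; last first.
    apply: leq_trans (leq_addr _ _); apply: leq_trans (leq_addr _ _).
    by move: sumle; rewrite s7.
  have noC7 : ~ has_cycle e 7 by move: forbidden; rewrite s7.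
  have sa : small a by rewrite /small (nv0 _ fa) a3.
  have bc_neq : b != c by edge.
  suff L : 0 < root_links f + big_links f.
    by move: sumle L; rewrite s7; move: (\sum_(_ | _) _) (root_links f) (big_links f); clear; lia.
  case: (big_face_near_tri noC7 f3 fab fac bc_neq a3 (nv0 _ fa) (nv0 _ fb) (nv0 _ fc)) => [av0|[h h8 ha]].
    rewrite ltn_addr // card_gt0; apply/set0Pn; exists a.
    by rewrite inE fa sa av0.
  rewrite ltn_addl // card_gt0; apply/set0Pn; exists (h, a).
  by rewrite inE /= h8 ha fa sa.
apply: leq_trans (leq_addr _ _); apply: leq_trans (leq_addr _ _).
have [a fa] : exists a, on_face f a.
  move: f3; rewrite /tri; case: (boolP [exists a, on_face f a]) => [/existsP//|none].
  rewrite /csize big1 // => x _; apply: big1 => y _.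
  case: (boolP (bd f x y)) => // xy; case/existsP: none; exists x; apply/on_faceP.
  by exists y.
have [b [c [U _ _ _ onf]]] := tri_cycle f3 fa.
have /and4P[_ fb fc _] := onf.
apply: leq_trans (sum_on tri_gift U onf); rewrite !big_cons big_nil /tri_gift.
rewrite (negPf (nv0 _ fa)) (negPf (nv0 _ fb)) (negPf (nv0 _ fc)).
have n3 v : on_face f v -> dg v == 3 = false.
  by move=> fv; apply: contraNF no3 => v3; apply/existsP; exists v; rewrite fv.
rewrite !n3 //; clear.
by do 3![case: eqP => _]; case: seven.
Qed.

(** Away from v0, vertices of degree 3 are pairwise non-adjacent, so a 5-cycle has at most two of
    them. *)
Lemma pen_receives f : pen f -> 3 <= \sum_(v | on_face f v) pen_gift v.
Proof.
move=> f5.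
have [v0f|v0f] := boolP (on_face f v0).
  have := @sum_on f pen_gift [:: v0] isT; rewrite /= v0f big_cons big_nil /pen_gift eqxx.
  by apply.
have nv0 v : on_face f v -> v != v0 by move=> fv; apply: contraNneq v0f => <-.
have [a fa] : exists a, on_face f a.
  move: f5; rewrite /pen; case: (boolP [exists a, on_face f a]) => [/existsP//|none].
  rewrite /csize big1 // => x _; apply: big1 => y _.
  case: (boolP (bd f x y)) => // xy; case/existsP: none; exists x; apply/on_faceP.
  by exists y.
have /on_faceP[b fab] := fa.
have [x [y [z [U [ab bx xy yz za] onf]]]] := pen_cycle f5 fab.
have /and5P[_ fb fx fy /andP[fz _]] := onf.
apply: leq_trans (sum_on pen_gift U onf); rewrite !big_cons big_nil /pen_gift.
rewrite (negPf (nv0 _ fa)) (negPf (nv0 _ fb)) (negPf (nv0 _ fx)) (negPf (nv0 _ fy)) (negPf (nv0 _ fz)).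
have P u v : e u v -> on_face f u -> on_face f v -> ~~ ((dg u == 3) && (dg v == 3)).
  by move=> uv fu fv; apply/negP => /andP[/eqP u3 /eqP v3]; apply: (adj3 uv) => //; apply: nv0.
have := P _ _ ab fa fb; have := P _ _ bx fb fx; have := P _ _ xy fx fy.
have := P _ _ yz fy fz; have := P _ _ za fz fa; clear.
by do 5!case: (_ == 3).
Qed.

Definition smalls h := #|[set a | on_face h a && small a]|.

(** Each such vertex meets at least two boundary edges, and no edge joins two such vertices. *)
Lemma smalls_le h : 2 * smalls h <= csize (bd h).
Proof.
set A := [set a | on_face h a && small a].
have AP u : u \in A -> on_face h u /\ small u by rewrite inE => /andP.
apply: (@leq_trans (\sum_(a in A) cdeg (bd h) a)).
  rewrite /smalls mulnC -sum_nat_const; apply: leq_sum => a /AP[ha _]; exact: cdeg_on_face.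
have indep u v : u \in A -> v \in A -> bd h u v = false.
  move=> /AP[_ /andP[uv /eqP u3]] /AP[_ /andP[vv /eqP v3]].
  by apply/negP => /bd_sub huv; apply: (adj3 huv).
have irr := even_chain_irr e_irr (face_bd_even e_sym dual h).
rewrite -(leq_pmul2l (isT : 0 < 2)) -(sum_cdeg (bd_sym h) irr) (bigID (mem A) xpredT) /=.
rewrite mul2n -addnn leq_add2l.
under eq_bigr do rewrite cdegE.
rewrite exchange_big (bigID (mem A)) /= big1 => [|v vA]; last first.
  by apply: big1 => u uA; rewrite indep.
rewrite add0n; apply: leq_sum => v vA; rewrite cdegE.
rewrite [leqRHS](bigID (mem A)) /=; apply: leq_trans (leq_addr _ _).
by apply: leq_sum => u _; rewrite bd_sym.
Qed.

(** For length n >= 8 the surplus 3n - 18 is at least n / 2, hence at least [smalls h]. *)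
Lemma face_charge h : 0 < csize (bd h) ->
  18 + (8 <= csize (bd h)) * smalls h <= 3 * csize (bd h) + 9 * tri h + 3 * pen h.
Proof.
move=> h0; have [/existsP[x /existsP[y xy]]|none] := boolP [exists x, exists y, bd h x y]; last first.
  move: h0; rewrite /csize big1 // => x _; apply: big1 => y _.
  case: (boolP (bd h x y)) => // xy; case/existsP: none; exists x.
  by apply/existsP; exists y.
have [h3 h4] := csize_face xy; have := smalls_le h; rewrite /tri /pen.
move: (csize _) (smalls h) h3 h4; clear => n s h3 h4 sn.
case: (leqP 8 n) => [n8|n7]; first lia.
by move: h3 h4 n7 {sn}; do 9![case: n => [|n] //]; lia.
Qed.

Lemma sum_tri_gifts (G : T -> nat) (P : pred F) (k : T -> nat) :
  (forall v, #|[set f | P f && on_face f v]| = k v) ->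
  \sum_(f | P f) \sum_(v | on_face f v) G v = \sum_v G v * k v.
Proof.
move=> kE; rewrite (exchange_big_dep xpredT) //=; apply: eq_bigr => v _.
by rewrite sum_nat_const mulnC -kE cardsE.
Qed.

(** A vertex of degree 3 lies on at most one triangular face, so each neighbour of v0 is counted at
    most once. *)
Lemma sum_root_links : \sum_(f | tri f) root_links f <= dg v0.
Proof.
have E f : root_links f = \sum_(v | small v && e v v0) on_face f v.
  rewrite /root_links -sum1_card big_mkcond [RHS]big_mkcond; apply: eq_bigr => v _.
  by rewrite inE; case: (on_face f v) => //=; case: (_ && _).
rewrite (eq_bigr _ (fun f _ => E f)) exchange_big /=.
rewrite /cdeg -sum1_card; rewrite big_mkcond [leqRHS]big_mkcond; apply: leq_sum => v _.
rewrite inE e_sym; case: ifP => // /andP[sv ->].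
apply: leq_trans (tau_small sv); rewrite /tau -sum1_card big_mkcond [leqRHS]big_mkcond.
by apply: leq_sum => f _; rewrite inE; case: (tri f); case: (on_face f v).
Qed.

Lemma sum_big_links : \sum_(f | tri f) big_links f <= \sum_h (8 <= csize (bd h)) * smalls h.
Proof.
have E f : big_links f = \sum_h (8 <= csize (bd h)) * \sum_(v | on_face h v && small v) on_face f v.
  rewrite /big_links -sum1_card.
  under [RHS]eq_bigr do rewrite big_distrr.
  rewrite pair_big_dep big_mkcond [RHS]big_mkcond; apply: eq_bigr => -[h v] _ /=.
  by rewrite inE /=; case: (7 < _); case: (on_face h v); case: (on_face f v); case: (small v).
rewrite (eq_bigr _ (fun f _ => E f)) exchange_big /=; apply: leq_sum => h _.
rewrite -big_distrr leq_mul2l; apply/orP; right.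
rewrite exchange_big /smalls -sum1_card big_mkcond [leqRHS]big_mkcond /=; apply: leq_sum => v _.
rewrite inE; case: ifP => // /andP[_ sv].
apply: leq_trans (tau_small sv); rewrite /tau -sum1_card big_mkcond [leqRHS]big_mkcond.
by apply: leq_sum => f _; rewrite inE; case: (tri f); case: (on_face f v).
Qed.

Lemma discharging : False.
Proof.
have sumB (G : T -> nat) : (forall v, v \notin B -> G v = 0) ->
    \sum_v G v = G v0 + \sum_(v in B :\ v0) G v.
  move=> G0; rewrite (bigID (mem B)) /= [X in _ + X]big1 ?addn0 => [|v /G0//].
  by rewrite (big_setD1 v0 v0B).
have out v w : v \notin B -> e v w = false by move=> vB; apply/negP => /e_in; rewrite (negPf vB).
have dg_out v : v \notin B -> dg v = 0.
  by move=> vB; apply: eq_card0 => w; rewrite !inE out.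
have degs : \sum_v dg v = 2 * csize e by apply: sum_cdeg.
have Bcard : #|B :\ v0| + 1 = #|B| by rewrite (cardsD1 v0 B) v0B addnC.
have eul := euler e_sym e_irr dual e_in (ltnW B_gt1).
set k := #|nonempty_faces e D| in eul; set m := csize e in degs eul.
pose A := \sum_v tri_gift v * tau v; pose P := \sum_v pen_gift v * pens v.
have gifts : A + P + 18 * #|B :\ v0| + dg v0 <= 12 * m.
  pose X v := tri_gift v * tau v + pen_gift v * pens v.
  have H1 : \sum_(v in B :\ v0) X v + 18 * #|B :\ v0| <= 6 * \sum_(v in B :\ v0) dg v.
    rewrite mulnC -sum_nat_const -big_split big_distrr; apply: leq_sum => v.
    by rewrite !inE => /andP[vv vB]; apply: vertex_gifts.
  have H2 : X v0 + dg v0 <= 6 * dg v0 := root_gifts.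
  have H3 : A + P = X v0 + \sum_(v in B :\ v0) X v.
    rewrite -big_split sumB // => v vB; have := tau_pens v.
    by rewrite dg_out // leqn0 addn_eq0 => /andP[/eqP-> /eqP->]; rewrite !muln0.
  have H4 := sumB _ dg_out; rewrite degs in H4.
  move: H1 H2 H3 H4; clear; lia.
pose S := \sum_h (8 <= csize (bd h)) * smalls h.
have triS : \sum_f 9 * tri f <= A + dg v0 + S.
  rewrite /A -(sum_tri_gifts _ (P := tri) (k := tau)) //.
  have -> : \sum_f 9 * tri f = \sum_(f | tri f) 9.
    by rewrite [RHS]big_mkcond; apply: eq_bigr => f _; case: (tri f).
  apply: leq_trans (leq_add (leq_add (leqnn _) sum_root_links) sum_big_links).
  by rewrite -!big_split; apply: leq_sum => f; apply: tri_receives.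
have penS : \sum_f 3 * pen f <= P.
  rewrite /P -(sum_tri_gifts _ (P := pen) (k := pens)) //.
  have -> : \sum_f 3 * pen f = \sum_(f | pen f) 3.
    by rewrite [RHS]big_mkcond; apply: eq_bigr => f _; case: (pen f).
  by apply: leq_sum => f; apply: pen_receives.
have facesS : 18 * k + S <= 3 * \sum_f csize (bd f) + \sum_f 9 * tri f + \sum_f 3 * pen f.
  rewrite mulnC -sum_nat_const big_distrr -!big_split [X in X + _]big_mkcond -big_split.
  apply: leq_sum => f _; rewrite inE; case: (posnP (csize (bd f))) => [->|/face_charge] //.
have csizes := sum_csize_faces.
have deg_ge : 3 * #|B :\ v0| <= 2 * m.
  rewrite -degs sumB // mulnC -sum_nat_const; apply: leq_trans (leq_addl _ _).
  by apply: leq_sum => v; rewrite !inE => /andP[vv vB]; apply: deg3.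
(* If k > 0, the sum of the bounds is k + #|B| <= m + 1, against Euler's m + 2 <= #|B| + k. If k =
   0, Euler's m < #|B| contradicts [deg_ge]. *)
move: B_gt1 Bcard eul gifts triS penS facesS csizes deg_ge.
rewrite -/m; move: (\sum_f csize _) (\sum_f 9 * _) (\sum_f 3 * _) => c t p.
by move: #|B| #|B :\ v0| k => b b' k; clear; case: (posnP k) => [->|]; lia.
Qed.

End Blocks.

(** * End blocks *)

Section Structure.
Variables (T F : finType) (e : rel T) (D : T -> T -> F) (l : nat).
Hypotheses (e_sym : symmetric e) (e_irr : irreflexive e) (dual : abstract_dual e D).
Hypotheses (l567 : l \in [:: 5; 6; 7]) (noC4 : ~ has_cycle e 4) (noCl : ~ has_cycle e l).

(* Minimal such sets induce an end block of G[S]. *)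
Definition rooted_part (S A : {set T}) : bool := [&& A \subset S, 1 < #|A| &
  [exists v0, (v0 \in A) && [forall x in A, (x != v0) ==>
    [forall y in S, e x y ==> (y \in A)]]]].

Lemma rooted_partP (S A : {set T}) : reflect
  [/\ A \subset S, 1 < #|A| & exists2 v0, v0 \in A &
     forall x y, x \in A -> x != v0 -> y \in S -> e x y -> y \in A]
  (rooted_part S A).
Proof.
apply: (iffP and3P) => -[AS A1].
  case/existsP=> v0 /andP[v0A /forall_inP H]; split=> //; exists v0 => // x y xA xv yS exy.
  by have /implyP/(_ xv)/forall_inP/(_ y yS)/implyP := H x xA; apply.
case=> v0 v0A H; split=> //; apply/existsP; exists v0; rewrite v0A.
apply/forall_inP => x xA; apply/implyP => xv; apply/forall_inP => y yS; apply/implyP.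
exact: H.
Qed.

Definition induced (B : {set T}) : rel T := [rel x y | [&& x \in B, y \in B & e x y]].

(** If z separates x from y, let K be the component of x. Rooted at z, either B minus K (if v0 is in
    K) or K with z added (if not) is a smaller rooted part. *)
Lemma minimal_part_connected (S B : {set T}) z x y : minset (rooted_part S) B ->
  z \in B -> x \in B -> y \in B -> x != z -> y != z ->
  connect [rel u v | [&& induced B u v, u != z & v != z]] x y.
Proof.
case/minsetP=> /rooted_partP[BS B1 [v0 v0B closed]] Bmin zB xB yB xz yz.
set r := [rel u v | _]; apply/idPn => nxy.
have [K KE] : exists K : {set T}, forall u, (u \in K) = connect r x u.
  by exists [set u | connect r x u] => u; rewrite inE.
have r_sym : connect_sym r.
  apply: sym_connect_sym => u v; rewrite /r /induced /= e_sym.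
  by rewrite (andbCA (u \in B)) (andbC (u != z)).
have KB u : u \in K -> u \in B /\ u != z.
  rewrite KE => /connectP[p + ->]; case/lastP: p => // p w.
  by rewrite rcons_path last_rcons => /andP[_ /and3P[/and3P[_ wB _] _ wz]].
have Kstep u w : u \in K -> w \in B -> w != z -> e u w -> w \in K.
  move=> uK wB wz euw; have [uB uz] := KB u uK; move: uK; rewrite !KE => xu.
  by apply: connect_trans xu (connect1 _); rewrite /r /induced /= uB wB euw uz wz.
have xK : x \in K by rewrite KE connect0.
have yK : y \notin K by rewrite KE.
have zK : z \notin K by apply/negP => /KB[_]; rewrite eqxx.
have [v0K|v0K] := boolP (v0 \in K).
  have /Bmin/(_ (subsetDl _ _)) BE : rooted_part S (B :\: K).
    apply/rooted_partP; split; first exact: subset_trans (subsetDl _ _) BS.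
      by rewrite (cardsD1 z) !inE zB zK (cardsD1 y) !inE yB yK yz.
    exists z => [|u w]; first by rewrite inE zB zK.
    rewrite !inE => /andP[uK uB] uz wS euw.
    have uv : u != v0 by apply: contraNneq uK => ->.
    have wB := closed u w uB uv wS euw; rewrite wB andbT; apply/negP => wK.
    by case/negP: uK; apply: (Kstep w) => //; rewrite e_sym.
  by have := xB; rewrite -BE inE xK.
have KzB : z |: K \subset B.
  by apply/subsetP => u; rewrite in_setU1 => /orP[/eqP->|/KB[]].
have /Bmin/(_ KzB) BE : rooted_part S (z |: K).
  apply/rooted_partP; split; first exact: subset_trans KzB BS.
    by rewrite cardsU1 zK (cardsD1 x K) xK.
  exists z => [|u w]; first by rewrite in_setU1 eqxx.
  rewrite in_setU1 => /orP[/eqP->|uK uz wS euw]; first by rewrite eqxx.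
  have [uB _] := KB u uK; have uv : u != v0 by apply: contraNneq v0K => <-.
  have wB := closed u w uB uv wS euw; rewrite in_setU1.
  by have [//|wz] := eqVneq w z; apply: Kstep euw.
by have := yB; rewrite -BE in_setU1 (negPf yz) (negPf yK).
Qed.

Lemma has_cycle_sub (e' : rel T) n : subrel e' e -> has_cycle e' n -> has_cycle e n.
Proof.
move=> sub [c [c2 cn /andP[cc uc]]]; exists c; split=> //.
by rewrite /ucycle uc (sub_cycle sub).
Qed.

(** In a minimal rooted part all vertices but the root keep their degree in G[S], so the absence of
    reducible configurations yields the hypotheses of [discharging]. *)
Lemma reducible_of_dual (S : {set T}) : S != set0 -> reducible e S.
Proof.
case/set0Pn=> s sS; apply/not_notP => nred.
have n2 v : v \in S -> 2 < nbrs e S v.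
  by move=> vS; rewrite ltnNge; apply/negP => v2; apply: nred; apply: Or31; exists v.
have S1 : 1 < #|S|.
  have sub : nbrs e S s <= #|S :\ s|.
    apply/subset_leq_card/subsetP => w; rewrite !inE => /andP[-> sw]; rewrite andbT.
    by apply: contraTneq sw => ->; rewrite e_irr.
  rewrite (cardsD1 s S) sS add1n ltnS; apply: leq_trans sub; do 2!apply: ltnW; exact: n2.
have SP : rooted_part S S.
  by apply/rooted_partP; split=> //; exists s.
have [B Bmin _] := minset_exists SP.
have := minsetp Bmin; case/rooted_partP=> BS B1 [v0 v0B closed].
have eB_sym : symmetric (induced B) by move=> x y; rewrite /induced /= e_sym andbCA.
have eB_irr : irreflexive (induced B) by move=> x; rewrite /induced /= e_irr !andbF.
have eB_sub : subrel (induced B) e by move=> x y /and3P[].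
have [D' dual'] := abstract_dual_sub e_sym eB_sym eB_sub dual.
have degE v : v \in B -> v != v0 -> cdeg (induced B) v = nbrs e S v.
  move=> vB vv; apply: eq_card => w; rewrite !inE /induced /= vB /=.
  case: (boolP (e v w)) => [vw|]; rewrite ?andbF ?andbT //.
  by apply/idP/idP => [/(subsetP BS)//|wS]; apply: closed vw.
apply: (@discharging T F (induced B) D' B eB_sym eB_irr dual' _ _ _ v0 _ (l == 7)) => //.
- by move=> x y /and3P[].
- by move=> z x y; apply: minimal_part_connected Bmin.
- by move/(has_cycle_sub eB_sub).
- by move=> v vB vv; rewrite degE // n2 // (subsetP BS).
- case: eqP l567 noCl => [->|l7] l567' noCl'; first by move/(has_cycle_sub eB_sub).
  case=> /(has_cycle_sub eB_sub) c5 /(has_cycle_sub eB_sub) c6.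
  by move: l567' noCl'; rewrite !inE => /or3P[]/eqP lE; rewrite lE in l7 *.
- move=> u v /and3P[uB vB euv] uv0 vv0; rewrite !degE // => u3 v3.
  apply: nred; apply: Or32; exists u, v; rewrite u3 v3; split=> //; exact: (subsetP BS).
- move=> a b c /and3P[aB bB ab] /and3P[_ cB bc] /and3P[_ _ ca] av bv cv.
  rewrite !degE // => a3 b4 c4; apply: nred; apply: Or33; exists a, b, c.
  by rewrite a3 b4 c4 ab bc ca; split=> //; split; apply: (subsetP BS).
Qed.

End Structure.

From mathcomp Require Import classical_sets prodnormedzmodule reals topology normedtype.
Import Order.TTheory GRing.Theory Num.Theory.
Import numFieldNormedType.Exports.

(** * From drawings to duals *)

Section Compactness.
Local Open Scope classical_set_scope.
Local Open Scope ring_scope.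
Variable R : realType.
Implicit Types (f g : R -> R * R) (a b c d h r s t eps : R).

(** Compactness of the segment turns a property valid locally for all small d into one valid for a
    uniform d. *)
Lemma segment_near_covering a b (P : R -> R -> Prop) :
  (forall s, a <= s <= b -> exists2 r : R, 0 < r & forall d t, 0 < d < r -> `|s - t| < r ->
     a <= t <= b -> P d t) ->
  exists2 d : R, 0 < d & forall t, a <= t <= b -> P d t.
Proof.
move=> loc.
have /compact_near_coveringP/near_covering_withinP cov := @segment_compact R a b.
have := cov R 0^'+ P _ _; case.
- move=> s; rewrite /= in_itv /= => /loc[r r0 Pr].
  exists (ball s r, [set d | 0 < d < r]) => /=.
    split; first exact: nbhsx_ballx.
    exists r => //= d; rewrite /ball_ /= sub0r normrN => dr d0; rewrite d0 /=.
    exact: le_lt_trans (ler_norm _) dr.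
  by move=> [t d] /= [st dr]; rewrite in_itv /= => tab; apply: Pr.
- move=> r /= r0 H; exists (r / 2); first by rewrite divr_gt0.
  move=> t tab; apply: (H (r / 2)); rewrite /= ?divr_gt0 ?in_itv //=.
  by rewrite sub0r normrN gtr0_norm ?divr_gt0 // ltr_pdivrMr // ltr_pMr // ltr1n.
Qed.

Lemma within_continuous_eps f a b : {within `[a, b], continuous f} ->
  forall s, a <= s <= b -> forall eps, 0 < eps ->
  exists2 r : R, 0 < r & forall t, a <= t <= b -> `|s - t| < r -> `|f s - f t| < eps.
Proof.
move=> /subspace_continuousP cf s sab eps eps0.
have /cf/cvgrPdist_lt/(_ eps eps0) : [set` `[a, b]] s by rewrite /= in_itv.
case=> r /= r0 H; exists r => // t tab st.
by apply: H; rewrite /= ?in_itv.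
Qed.

Lemma uniformly_continuous_segment f a b : {within `[a, b], continuous f} ->
  forall eps, 0 < eps -> exists2 d : R, 0 < d & forall s t, a <= s <= b -> a <= t <= b ->
    `|s - t| < d -> `|f s - f t| < eps.
Proof.
move=> /within_continuous_eps cf eps eps0.
have [|d d0 H] := @segment_near_covering a b
  (fun d s => forall t, a <= t <= b -> `|s - t| < d -> `|f s - f t| < eps).
  move=> s sab; have [|r r0 Hr] := cf s sab (eps / 2); first by rewrite divr_gt0.
  exists (r / 2); first by rewrite divr_gt0.
  move=> d t /andP[_ dr] st tab u uab tu.
  have ft : `|f s - f t| < eps / 2 by apply: Hr => //; lra.
  have fu : `|f s - f u| < eps / 2.
    by apply: Hr => //; have := ler_distD t s u; lra.
  by have := ler_distD (f s) (f t) (f u); rewrite (distrC (f t) (f s)); lra.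
by exists d => // s t sab tab; apply: H.
Qed.

Lemma bounded_segment f a b : {within `[a, b], continuous f} ->
  exists2 M : R, 0 < M & forall s, a <= s <= b -> `|f s| <= M.
Proof.
move=> /within_continuous_eps cf.
(* The bound is sought in the form 1 / d, so that it too becomes a statement about small d. *)
have [|d d0 H] := @segment_near_covering a b (fun d s => `|f s| <= d^-1).
  move=> s sab; have [r r0 Hr] := cf s sab 1 ltr01.
  have f0 : 0 < `|f s| + 1 by apply: ltr_wpDl.
  exists (Num.min r (`|f s| + 1)^-1); first by rewrite lt_min r0 invr_gt0.
  move=> d t /andP[d0]; rewrite !lt_min => /andP[_ dlt] /andP[st _] tab.
  have /ltW dle : `|f s| + 1 < d^-1 by rewrite -(invrK (_ + 1)) ltf_pV2 ?posrE ?invr_gt0.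
  apply: le_trans dle; have := Hr t tab st.
  have := ler_distD (f s) (f t) 0; rewrite !subr0 (distrC (f t)); lra.
by exists d^-1 => //; rewrite invr_gt0.
Qed.

(** Compactness is used twice: for fixed s along the second arc, then along the first. *)
Lemma separated_segments f g a b c d :
  {within `[a, b], continuous f} -> {within `[c, d], continuous g} ->
  (forall s t, a <= s <= b -> c <= t <= d -> f s <> g t) ->
  exists2 h : R, 0 < h & forall s t, a <= s <= b -> c <= t <= d -> h <= `|f s - g t|.
Proof.
move=> /within_continuous_eps cf /within_continuous_eps cg fg.
have [|h h0 H] := @segment_near_covering a b
  (fun h s => forall t, c <= t <= d -> h <= `|f s - g t|); last by exists h => // s t sab; apply: H.
move=> s sab.
have [|h h0 H] := @segment_near_covering c d
  (fun h t => forall u, a <= u <= b -> `|s - u| < h -> h <= `|f u - g t|); last first.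
  exists h => // h' t /andP[h'0 h'h] st tab u uab.
  by apply: le_trans (ltW h'h) _; apply: H.
move=> t tcd; set z := `|f s - g t|.
have z0 : 0 < z / 3.
  by rewrite divr_gt0 // normr_gt0 subr_eq0; apply/eqP/fg.
have [r1 r10 H1] := cf s sab _ z0; have [r2 r20 H2] := cg t tcd _ z0.
exists (Num.min (z / 3) (Num.min r1 r2)); first by rewrite !lt_min z0 r10.
move=> h t'; rewrite !lt_min => /and4P[h0 hz h1 h2] /and3P[_ _ tt'] t'cd u uab su.
have := H1 u uab (lt_trans su h1); have := H2 t' t'cd tt'.
have := ler_distD (f u) (f s) (g t); have := ler_distD (g t') (f u) (g t).
rewrite -/z (distrC (g t') (g t)); lra.
Qed.

Lemma common_bound (I : finType) (P : I -> R -> Prop) :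
  (forall i h h', P i h -> 0 < h' <= h -> P i h') ->
  (forall i, exists2 h : R, 0 < h & P i h) -> exists2 h : R, 0 < h & forall i, P i h.
Proof.
move=> mono ex.
have /choice[h hP] : forall i, exists h, 0 < h /\ P i h.
  by move=> i; have [h ? ?] := ex i; exists h.
pose H := \big[Num.min/1]_i h i.
have H0 : 0 < H.
  by apply: (big_ind (fun x => 0 < x)) => // [x y x0 y0|i _]; [rewrite lt_min x0|case: (hP i)].
exists H => // i; have [_ Pi] := hP i; apply: mono Pi _; rewrite H0 /H.
exact: bigmin_le_cond.
Qed.

End Compactness.

(** * From a plane drawing to a sampled one *)

Section PlanarDual.
Local Open Scope classical_set_scope.
Local Open Scope ring_scope.
Variables (R : realType) (T : finType) (e : rel T).
Variables (p : T -> R * R) (g : T -> T -> R -> R * R).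
Hypotheses (e_sym : symmetric e) (e_irr : irreflexive e) (Dr : plane_drawing e p g).

(* [false] stands for the first third of an arc, [true] for its middle third. *)
Let lo (b : bool) : R := if b then 3^-1 else 0.
Let hi (b : bool) : R := if b then 2 / 3 else 3^-1.

(** The condition under which a third of xy and a third of x'y' must be disjoint. The case of a
    first and a middle third is stated in one order only, hence the [False]. *)
Let apart (x y x' y' : T) (b b' : bool) : Prop := match b, b' with
  | false, false => x <> x'
  | true, false => x' <> x /\ x' <> y
  | true, true => ~ ((x = x' /\ y = y') \/ (x = y' /\ y = x'))
  | false, true => False
  end.

Let eq_edge (x y x' y' : T) : [set x; y]%SET = [set x'; y']%SET ->
  (x = x' /\ y = y') \/ (x = y' /\ y = x').
Proof.
move=> E.
have : x \in [set x'; y']%SET by rewrite -E !inE eqxx.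
have : y \in [set x'; y']%SET by rewrite -E !inE eqxx orbT.
have : x' \in [set x; y]%SET by rewrite E !inE eqxx.
have : y' \in [set x; y]%SET by rewrite E !inE eqxx orbT.
rewrite !inE => /orP[]/eqP-> /orP[]/eqP-> /orP[]/eqP ? /orP[]/eqP ?; subst; by [left|right].
Qed.

Let apart_neq x y x' y' b b' (s t : R) : e x y -> e x' y' -> apart x y x' y' b b' ->
  lo b <= s <= hi b -> lo b' <= t <= hi b' -> g x y s <> g x' y' t.
Proof.
move=> exy exy' ap sI tI.
have s01 : s = 0 /\ b = false \/ 0 < s < 1.
  by move: sI; rewrite /lo /hi; case: (b) => sI; [right; lra|]; have [->|] := eqVneq s 0; [left|right; lra].
have t01 : t = 0 /\ b' = false \/ 0 < t < 1.
  by move: tI; rewrite /lo /hi; case: (b') => tI; [right; lra|]; have [->|] := eqVneq t 0; [left|right; lra].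
case: t01 => [[t0 b'0]|t01].
  subst t b'; rewrite (drawing_arc_src Dr exy').
  case: s01 => [[s0 b0]|s01]; last by apply: (drawing_avoids_vertices Dr exy); rewrite in_itv.
  by subst s b; rewrite (drawing_arc_src Dr exy) => /(drawing_vertex_inj Dr) /ap.
case: s01 => [[s0 b0]|s01].
  subst s b; rewrite (drawing_arc_src Dr exy) => /esym.
  by apply: (drawing_avoids_vertices Dr exy'); rewrite in_itv.
have [/eq_edge E|ne] := eqVneq [set x; y]%SET [set x'; y']%SET; last first.
  by apply: (drawing_no_crossing Dr exy exy' ne); rewrite in_itv.
move: ap sI tI; case: b => /=; case: b' => /=.
- by move/(_ E).
- by case=> n1 n2; case: E => -[xx yy]; [case: n1|case: n2].
- by [].
move=> n1 sI tI; case: E => -[? ?]; first by [].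
(* These are the first thirds at the two ends of one edge. After reversal injectivity applies, as s
   <= 1/3 < 2/3 <= 1 - t. *)
subst x' y'; rewrite (drawing_arc_rev Dr exy) ?in_itv /=; last by lra.
by move/(drawing_arc_inj Dr exy); rewrite !in_itv /=; rewrite /lo /hi in sI tI; lra.
Qed.

Let arc_cont x y b : e x y -> {within `[lo b, hi b], continuous (g x y)}.
Proof.
move=> exy; apply: continuous_subspaceW (drawing_arc_cont Dr exy) => t /=.
by rewrite !in_itv /= /lo /hi; case: b; lra.
Qed.

Let separation : exists2 h : R, 0 < h & forall x y x' y' b b' (s t : R), e x y -> e x' y' ->
  apart x y x' y' b b' -> lo b <= s <= hi b -> lo b' <= t <= hi b' ->
  h <= `|g x y s - g x' y' t|.
Proof.
pose P (i : T * T * T * T * bool * bool) (h : R) := let: (x, y, x', y', b, b') := i in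
  e x y -> e x' y' -> apart x y x' y' b b' ->
  forall s t, lo b <= s <= hi b -> lo b' <= t <= hi b' -> h <= `|g x y s - g x' y' t|.
have [|i|h h0 H] := @common_bound R _ P.
- move=> [[[[[x y] x'] y'] b] b'] h h' Ph /andP[_ h'h] exy exy' ap s t sI tI.
  exact: le_trans h'h (Ph exy exy' ap s t sI tI).
- case: i => [[[[[x y] x'] y'] b] b'].
  have [|nP] := pselect (e x y /\ e x' y' /\ apart x y x' y' b b'); last first.
    by exists 1 => // exy exy' ap; case: nP.
  case=> exy [exy' ap].
  have [h h0 H] := separated_segments (@arc_cont x y b exy) (@arc_cont x' y' b' exy')
    (fun s t => apart_neq exy exy' ap).
  by exists h => // _ _ _.
exists h => // x y x' y' b b' s t exy exy' ap sI tI.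
exact: (H (x, y, x', y', b, b')).
Qed.

Let uniform eps : 0 < eps -> exists2 d : R, 0 < d & forall x y (s t : R), e x y ->
  0 <= s <= 1 -> 0 <= t <= 1 -> `|s - t| < d -> `|g x y s - g x y t| < eps.
Proof.
move=> eps0.
pose P (i : T * T) (d : R) := e i.1 i.2 -> forall s t : R, 0 <= s <= 1 -> 0 <= t <= 1 ->
  `|s - t| < d -> `|g i.1 i.2 s - g i.1 i.2 t| < eps.
have [|i|d d0 H] := @common_bound R _ P.
- move=> i h h' Ph /andP[_ h'h] exy s t s01 t01 st.
  by apply: Ph => //; apply: lt_le_trans st h'h.
- have [exy|nexy] := boolP (e i.1 i.2); last by exists 1 => // /(negP nexy).
  have [d d0 H] := uniformly_continuous_segment (drawing_arc_cont Dr exy) eps0.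
  by exists d => //= _; apply: H.
by exists d => // x y s t exy; apply: (H (x, y)).
Qed.

Let bounded : exists2 M : R, 0 < M & forall x y (t : R), e x y -> 0 <= t <= 1 ->
  `|g x y t| <= M.
Proof.
pose P (i : T * T) (d : R) := e i.1 i.2 -> forall t : R, 0 <= t <= 1 -> `|g i.1 i.2 t| <= d^-1.
have [|i|d d0 H] := @common_bound R _ P.
- move=> i h h' Ph /andP[h'0 h'h] exy t t01.
  apply: le_trans (Ph exy t t01) _; rewrite lef_pV2 ?posrE //.
  exact: lt_le_trans h'h.
- have [exy|nexy] := boolP (e i.1 i.2); last by exists 1 => // /(negP nexy).
  have [M M0 H] := bounded_segment (drawing_arc_cont Dr exy).
  by exists M^-1; rewrite ?invr_gt0 // => _ t; rewrite invrK; apply: H.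
by exists d^-1; rewrite ?invr_gt0 // => x y t exy; apply: (H (x, y)).
Qed.

Let truncn_near (u v : R) : 0 <= u -> 0 <= v -> `|u - v| < 1 ->
  (Num.truncn u <= Num.truncn v + 1)%N.
Proof.
move=> u0 v0 uv; rewrite addn1 -ltnS truncn_lt_nat //.
have := truncnS_gt v; rewrite -[X in _ < X -> _]natr1 -[X in _ -> _ < X]natr1 -[X in _ -> _ < X + _]natr1.
by have := ler_norm (u - v); lra.
Qed.

Let truncn_far (u v : R) : 0 <= u -> 0 <= v -> (Num.truncn u <= Num.truncn v + 2)%N ->
  u - v < 3.
Proof.
move=> u0 v0 uv.
have /andP[_ u1] := truncn_itv u0; have /andP[v1 _] := truncn_itv v0.
have : ((Num.truncn u).+1%:R : R) <= (Num.truncn v + 3)%:R by rewrite ler_nat; lia.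
by rewrite natrD; lra.
Qed.

Lemma plane_drawing_dual : exists (F : finType) (D : T -> T -> F), abstract_dual e D.
Proof.
have [h h0 sep] := separation.
(* [eps] is the side of the squares: points in squares at distance at most 2 differ by less than 3
   eps = h in each coordinate. *)
pose eps := h / 3; have eps0 : 0 < eps by rewrite divr_gt0.
have [d d0 unif] := uniform eps0.
have [M M0 bnd] := bounded.
(* Then 1 / (3n) < d, so consecutive samples differ by less than one side. *)
pose n := (Num.truncn d^-1).+1.
(* The shift by K makes all rescaled coordinates nonnegative, with values up to 2K, before
   truncation. *)
pose K : R := M / eps.
have K0 : 0 < K by rewrite divr_gt0.
have n30 : (0 : R) < (3 * n)%:R by rewrite ltr0n muln_gt0.
pose tm k : R := k%:R / (3 * n)%:R.
have tm01 k : (k <= 3 * n)%N -> 0 <= tm k <= 1.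
  by move=> kn; rewrite divr_ge0 ?ler0n // ler_pdivrMr // mul1r ler_nat.
have tm_lo k : (k <= n)%N -> lo false <= tm k <= hi false.
  move=> kn; rewrite /lo /hi divr_ge0 ?ler0n //= ler_pdivrMr // natrM mulKf ?ler_nat //.
  by rewrite pnatr_eq0.
have tm_mid k : (n <= k <= 2 * n)%N -> lo true <= tm k <= hi true.
  move=> /andP[nk kn]; rewrite /lo /hi ler_pdivlMr // ler_pdivrMr // natrM mulKf ?pnatr_eq0 //.
  by rewrite ler_nat nk /= mulrA divfK ?pnatr_eq0 // -natrM ler_nat.
have tm_rev k : (k <= 3 * n)%N -> tm (3 * n - k)%N = 1 - tm k.
  by move=> kn; rewrite /tm natrB // mulrBl divff // gt_eqF.
have tm_step k : `|tm k - tm k.+1| < d.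
  rewrite /tm -mulrBl -natr1 opprD addrA subrr sub0r mulN1r normrN normfV gtr0_norm //.
  rewrite -(invrK d) ltf_pV2 ?posrE ?invr_gt0 //.
  apply: lt_le_trans (truncnS_gt _) _; rewrite ler_nat -/n; lia.
pose u (z : R) := z / eps + K.
have u0 (z : R) : `|z| <= M -> 0 <= u z.
  move=> zM; rewrite /u /K -mulrDl divr_ge0 ?(ltW eps0) //.
  by have := ler_norm (- z); rewrite normrN; lra.
have uM (z : R) : `|z| <= M -> u z <= K + K.
  move=> zM; rewrite /u lerD2r /K ler_pM2r ?invr_gt0 //.
  exact: le_trans (ler_norm _) zM.
have uB (z z' : R) : u z - u z' = (z - z') / eps by rewrite /u mulrBl opprD addrACA subrr addr0.
pose X x y k := (Num.truncn (u (g x y (tm k)).1), Num.truncn (u (g x y (tm k)).2)).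
pose X0 x := (Num.truncn (u (p x).1), Num.truncn (u (p x).2)).
have bnd1 x y k : e x y -> (k <= 3 * n)%N ->
    `|(g x y (tm k)).1| <= M /\ `|(g x y (tm k)).2| <= M.
  move=> exy kn; have := bnd x y (tm k) exy (tm01 k kn).
  by rewrite prod_normE ge_max => /andP[].
have near x y x' y' k k' : e x y -> e x' y' -> (k <= 3 * n)%N -> (k' <= 3 * n)%N ->
    within_dist 2 (X x y k) (X x' y' k') -> `|g x y (tm k) - g x' y' (tm k')| < h.
  move=> exy exy' kn kn' [c1 c2 c3 c4].
  have [b1 b2] := bnd1 _ _ _ exy kn; have [b1' b2'] := bnd1 _ _ _ exy' kn'.
  have H z z' : `|z| <= M -> `|z'| <= M ->
      (Num.truncn (u z) <= Num.truncn (u z') + 2)%N -> z - z' < h.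
    move=> zM z'M /(truncn_far (u0 _ zM) (u0 _ z'M)).
    by rewrite uB ltr_pdivrMr // /eps mulrCA divff ?pnatr_eq0 // mulr1.
  rewrite prod_normE gt_max /= !ltr_norml ![- h < _]ltrNl !opprB.
  by rewrite !H.
apply: (@sampled_drawing_dual T e (Num.truncn (K + K)) n X X0 e_sym e_irr).
split.
- move=> x y k exy kn; have [b1 b2] := bnd1 _ _ _ exy kn.
  by split; apply: le_truncn; apply: uM.
- move=> x y k exy kn; have [b1 b2] := bnd1 _ _ _ exy (ltnW kn).
  have [b1' b2'] := bnd1 _ _ _ exy kn.
  have := unif x y _ _ exy (tm01 _ (ltnW kn)) (tm01 _ kn) (tm_step k).
  have lt1 z z' : `|z - z'| < eps -> `|u z - u z'| < 1.
    by rewrite uB normrM normfV (gtr0_norm eps0) ltr_pdivrMr // mul1r.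
  rewrite prod_normE gt_max => /andP[/lt1 l1 /lt1 l2].
  by split; apply: truncn_near; rewrite ?u0 // distrC.
- by move=> x y exy; rewrite /X /X0 /tm mul0r (drawing_arc_src Dr exy).
- move=> x y k exy kn; rewrite /X tm_rev // (drawing_arc_rev Dr exy) //.
  by rewrite in_itv /=; apply: tm01.
- move=> x y x' y' k k' exy exy' kn kn' c.
  have [k3 k3'] : (k <= 3 * n)%N /\ (k' <= 3 * n)%N by clear -kn kn'; lia.
  have [//|ne] := pselect (x = x').
  have := near _ _ _ _ _ _ exy exy' k3 k3' c; rewrite ltNge (sep x y x' y' false false) //;
    try exact: tm_lo.
- move=> x y x' y' k k' exy exy' kn kn' c.
  have [k3 k3'] : (k <= 3 * n)%N /\ (k' <= 3 * n)%N by clear -kn kn'; lia.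
  have [//|ne] := pselect (x' = x \/ x' = y).
  have := near _ _ _ _ _ _ exy exy' k3 k3' c; rewrite ltNge (sep x y x' y' true false) //; try (exact: tm_lo || exact: tm_mid).
    by split=> E; apply: ne; [left|right].
- move=> x y x' y' k k' exy exy' kn kn' c.
  have [k3 k3'] : (k <= 3 * n)%N /\ (k' <= 3 * n)%N by clear -kn kn'; lia.
  have [//|ne] := pselect ((x = x' /\ y = y') \/ (x = y' /\ y = x')).
  have := near _ _ _ _ _ _ exy exy' k3 k3' c; rewrite ltNge (sep x y x' y' true true) //;
    try exact: tm_mid.
Qed.
End PlanarDual.

Theorem mainTheorem2 (R : realType) (T : finType) (e : rel T) (l : nat)
  (e_sym : symmetric e) (e_irr : irreflexive e)
  (l567 : l \in [:: 5; 6; 7])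
  (e_planar : planar R e)
  (no_C4 : ~ has_cycle e 4) (no_Cl : ~ has_cycle e l) :
  paintable e 1 3.
Proof.
case: e_planar => p [g Dr].
have [F [D dual]] := plane_drawing_dual e_sym e_irr Dr.
apply: (paintable_of_reducible e_irr e_sym) => S.
exact: (reducible_of_dual e_sym e_irr dual l567 no_C4 no_Cl).
Qed.
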